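(* Given $\varepsilon>0$ there exists $\delta=\delta(\varepsilon)>0$ such that for every JB$^*$-triple $E$ and every pair of tripotents $u,v$ in $E$ with $$1-\delta<\|u\pm v\|<1+\delta$$ (both for the sign $+$ and for the sign $-$), we have $\|u-P_0(v)(u)\|<\varepsilon$ and $\|v-P_0(u)(v)\|<\varepsilon$.
   Context: A JB$^*$-triple is a complex Banach space $E$ with a continuous triple product $\{\cdot,\cdot,\cdot\}$, symmetric and bilinear in the outer variables and conjugate linear in the middle one, such that, with $L(a,b)y:=\{a,b,y\}$, $L(x,y)\{a,b,c\}=\{L(x,y)a,b,c\}-\{a,L(y,x)b,c\}+\{a,b,L(x,y)c\}$, $\|L(a,a)\|=\|a\|^2$, and $L(a,a)$ is a hermitian operator with non-negative spectrum. A tripotent is an element $u$ with $\{u,u,u\}=u$. Its Peirce-0 projection is $P_0(u)=(\mathrm{id}_E-L(u,u))(\mathrm{id}_E-2L(u,u))$, a contractive projection onto the kernel of $L(u,u)$. *)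

(* Defs.v *)
From mathcomp Require Import all_boot all_order all_algebra.
From mathcomp Require Import all_classical all_reals all_analysis.
From mathcomp Require Export complex.

Set Implicit Arguments.
Unset Strict Implicit.
Unset Printing Implicit Defensive.

Import Order.TTheory GRing.Theory Num.Theory.
Import numFieldNormedType.Exports.

Local Open Scope classical_set_scope.
Local Open Scope ring_scope.
Local Open Scope complex_scope.

Section BanachSpace.
Variables (R : realType) (E : completeNormedModType R[i]).
Implicit Types (T S : E -> E) (x : E) (lam : R[i]).

(* The norm of E is R[i]-valued, with nonnegative real values. *)
Definition rnorm x : R := complex.Re `|x|.

(* For a bounded linear T; [sup] returns 0 on unbounded sets. *)
Definition opnorm T : R := sup [set rnorm (T x) | x in [set x | rnorm x <= 1]].

Definition bounded_operator T : Prop := linear T /\ continuous T.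

(* exp(z T) x, as the sum of a norm-convergent series when T is bounded. *)
Definition exp_op (z : R[i]) T x : E :=
  limn (series (fun k : nat => (z ^+ k / k`!%:R) *: iter k T x)).

(* T is hermitian when exp(i t T) is an isometry for every real t. *)
Definition hermitian_operator T : Prop :=
  bounded_operator T /\
  forall (t : R) x, rnorm (exp_op ('i * t%:C) T x) = rnorm x.

Definition invertible_operator T : Prop :=
  exists S, [/\ bounded_operator S, cancel T S & cancel S T].

Definition spectrum T : set R[i] :=
  [set lam | ~ invertible_operator (fun x => T x - lam *: x)].

(* In the order of R[i], 0 <= lam means that lam is real and nonnegative. *)
Definition nonneg_spectrum T : Prop := forall lam, spectrum T lam -> 0 <= lam.

End BanachSpace.

Section JBstarTriple.
Variables (R : realType) (E : completeNormedModType R[i]).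
Variable tp : E -> E -> E -> E.

Definition Lop (a b : E) : E -> E := fun y => tp a b y.

Record JBstar_triple : Prop := {
  JB_continuous : continuous (fun p : E * E * E => tp p.1.1 p.1.2 p.2);
  JB_sym : forall x y z, tp x y z = tp z y x;
  JB_linear : forall y z, linear (fun x => tp x y z);
  JB_conj_linear : forall x z (a : R[i]) y y',
    tp x (a *: y + y') z = a^* *: tp x y z + tp x y' z;
  JB_jordan : forall x y a b c,
    Lop x y (tp a b c) =
    tp (Lop x y a) b c - tp a (Lop y x b) c + tp a b (Lop x y c);
  JB_norm : forall a, opnorm (Lop a a) = rnorm a ^+ 2;
  JB_hermitian : forall a, hermitian_operator (Lop a a);
  JB_spectrum : forall a, nonneg_spectrum (Lop a a)
}.

Definition tripotent (u : E) : Prop := tp u u u = u.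

(* (id - L(u,u)) o (id - 2 L(u,u)) *)
Definition peirce0 (u : E) : E -> E :=
  (fun x => x - Lop u u x) \o (fun x => x - 2 *: Lop u u x).

End JBstarTriple.

(* Main.v *)
Require Import Defs.
From mathcomp Require Import all_boot all_order all_algebra.
From mathcomp Require Import all_classical all_reals all_analysis.
From mathcomp Require Import ring lra zify.
Import numFieldNormedType.Exports.
Import Order.TTheory GRing.Theory Num.Theory.
Local Open Scope ring_scope.

Set Implicit Arguments.
Unset Strict Implicit.
Unset Printing Implicit Defensive.

(** Write [S = L(v,v)], [T = L(u,u)], and let [P_j] and [R_j] be the Peirce
    projections of [u] and of [v]. As [u - P_0(v) u = 3 S u - 2 S^2 u], the
    claim is that [S u] is small, with a bound that is uniform in the triple;
    the other half follows by exchanging [u] and [v].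

    The norm condition enters through
    [2 (T + S) = L(u+v,u+v) + L(u-v,u-v)]: on the Peirce-2 space of [u], where
    [T] is the identity, the compression [K = P_2 S] satisfies
    [|x + K x| <= (1 + small) |x|]. On the other hand the isometries
    [exp (i t S)] extend to contractions [W(z) = R_0 + z R_1 + z^2 R_2] for
    [|z| <= 1] (averages of isometries, [rotation_contraction]). Compressed to
    the Peirce-2 space of [u] and expanded at [z = 1 - s], they show that
    [1 + z K] is almost contractive to first order for [z] in a half-plane, and
    so for all small complex [z]. An operator with this property is small, since
    Cauchy's estimate extracts [n z K] from the bounded operator [(1 + z K)^n]
    ([small_of_flat]). Once the term of order [s] is small, the same principle
    applies to the next coefficient of the expansion, because [s ^ 2] and
    [s ^ 4] take all arguments as [s] runs over the disc [|1 - s| <= 1]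
    ([small_of_cusp]): the compressions of [R_2] and, by means of the contraction
    [P_2 W(z) (1 - 2 P_1) W(z) P_2], of [R_2 P_1 R_2] are small as well.

    The commutator [[S, T] = L(S u, u) - L(u, S u)] turns the off-diagonal
    blocks of [S] into triple products with the single vector [y = P_1 S u],
    which differs from [S u] by the small vector [K u]. The estimates above then
    say that [{u,y,y}] and [{u,y,{y,y,y}}] are small, and the Jordan identity
    yields that [L(y,y)^2 y] is small ([nrm_quintic]). Finally [exp (i t L(y,y))]
    is isometric for all real [t], which forbids [L(y,y) x] to be large when
    [L(y,y)^2 x] is small ([isometric_exp_sqr_small]). Hence [{y,y,y}] is small,
    then [L(y,y)^3], then [L(y,y)], whose norm is [|y|^2]
    ([small_of_quintic]).

    The argument uses an algebraically closed field [C] whose real and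
    imaginary parts lie in [R]; the complex numbers [R[i]] are put in its place
    at the end. *)

(** * Deciding linear identities in a module *)

Inductive lincomb (K : Type) :=
  | LVar of nat
  | LZero
  | LAdd of lincomb K & lincomb K
  | LOpp of lincomb K
  | LScale of K & lincomb K.
Arguments LVar {K}.
Arguments LZero {K}.

Fixpoint lc_eval (K : nzRingType) (V : lmodType K) (env : seq V)
    (e : lincomb K) : V :=
  match e with
  | LVar n => nth 0 env n
  | LZero => 0
  | LAdd e1 e2 => lc_eval env e1 + lc_eval env e2
  | LOpp e1 => - lc_eval env e1
  | LScale a e1 => a *: lc_eval env e1
  end.

Fixpoint lc_coef (K : nzRingType) (e : lincomb K) (i : nat) : K :=
  match e with
  | LVar n => if eqn n i then 1 else 0
  | LZero => 0
  | LAdd e1 e2 => lc_coef e1 i + lc_coef e2 i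
  | LOpp e1 => - lc_coef e1 i
  | LScale a e1 => a * lc_coef e1 i
  end.

Fixpoint lc_agree (K : nzRingType) (e1 e2 : lincomb K) (n : nat) : Prop :=
  match n with
  | 0 => True
  | S m => lc_coef e1 m = lc_coef e2 m /\ lc_agree e1 e2 m
  end.

Lemma lc_evalE (K : nzRingType) (V : lmodType K) (env : seq V) e :
  lc_eval env e = \sum_(i < size env) lc_coef e i *: nth 0 env i.
Proof.
elim: e => [n||e1 IH1 e2 IH2|e IH|a e IH] /=.
- have [lt_n|le_n] := ltnP n (size env); last first.
    rewrite nth_default // big1 // => i _.
    have -> : eqn n i = false.
      by apply/eqnP => eni; move: (ltn_ord i); rewrite -eni ltnNge le_n.
    by rewrite scale0r.
  rewrite (bigD1 (Ordinal lt_n)) //= -[eqn n n]/(n == n) eqxx scale1r big1 ?addr0 // => i.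
  rewrite -val_eqE /= => ne; have -> : eqn n i = false.
    by apply/eqnP => eni; rewrite eni eqxx in ne.
  by rewrite scale0r.
- by rewrite big1 // => i _; rewrite scale0r.
- by rewrite IH1 IH2 -big_split /=; apply: eq_bigr => i _; rewrite scalerDl.
- by rewrite IH -sumrN; apply: eq_bigr => i _; rewrite scaleNr.
- by rewrite IH scaler_sumr; apply: eq_bigr => i _; rewrite scalerA.
Qed.

Lemma lc_agreeP (K : nzRingType) (V : lmodType K) (env : seq V) e1 e2 :
  lc_agree e1 e2 (size env) -> lc_eval env e1 = lc_eval env e2.
Proof.
move=> h; rewrite !lc_evalE; apply: eq_bigr => -[i /= lt_i] _; congr (_ *: _).
by elim: (size env) h lt_i => // n IH [hn hs]; rewrite ltnS leq_eqVlt;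
  case/orP => [/eqP ->|/(IH hs)].
Qed.

Ltac lc_insert x env :=
  match env with
  | nil => constr:(x :: nil)
  | x :: _ => env
  | ?y :: ?s => let s' := lc_insert x s in constr:(y :: s')
  end.

Ltac lc_index x env :=
  match env with
  | x :: _ => constr:(0%N)
  | _ :: ?s => let n := lc_index x s in constr:(S n)
  end.

Ltac lc_atoms e env :=
  match e with
  | (?a + ?b)%R => let env' := lc_atoms a env in lc_atoms b env'
  | (- ?a)%R => lc_atoms a env
  | (?k *: ?a)%R => lc_atoms a env
  | 0%R => env
  | ?x => lc_insert x env
  end.

Ltac lc_reify e env :=
  match e with
  | (?a + ?b)%R =>
      let a' := lc_reify a env in let b' := lc_reify b env in
      open_constr:(LAdd a' b')
  | (- ?a)%R => let a' := lc_reify a env in open_constr:(LOpp a')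
  | (?k *: ?a)%R => let a' := lc_reify a env in open_constr:(LScale k a')
  | 0%R => open_constr:(@LZero _)
  | ?x => let n := lc_index x env in open_constr:(@LVar _ n)
  end.

(** An identity between linear combinations holds once the coefficients of
    each atom agree, and [ring] decides the latter. *)
Ltac lc_goals V :=
  match goal with |- ?a = ?b =>
    let env0 := lc_atoms a constr:(@nil V) in
    let env := lc_atoms b env0 in
    let a' := lc_reify a env in
    let b' := lc_reify b env in
    apply: (@lc_agreeP _ _ env a' b');
    cbv [lc_agree lc_coef eqn size]; do ?split
  end.

Ltac lmod_coefficients := match goal with |- @eq ?V _ _ => lc_goals V end.
Ltac lmod := lmod_coefficients; try ring.

(** * Complex scalars and real-valued norms *)

Lemma ler_eq (R : realDomainType) (x y : R) : x = y -> x <= y.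
Proof. by move=> ->. Qed.


(** A closed field with conjugation plays the role of the complex numbers over
    [R] when the field of its real elements is identified with [R]. *)
Class complexOver (R : realType) (C : numClosedFieldType) := ComplexOver {
  rc : {rmorphism R -> C};
  re : C -> R;
  im : C -> R;
  rc_re : forall z, rc (re z) = 'Re z;
  rc_im : forall z, rc (im z) = 'Im z;
  ler_rc : {mono rc : x y / x <= y}
}.

Section RealNorm.
Context {R : realType} {C : numClosedFieldType} {RC : complexOver R C}.
Implicit Types (z : C) (r : R).

Lemma rc_inj : injective rc.
Proof. exact: fmorph_inj. Qed.

Lemma ltr_rc : {mono rc : x y / x < y}.
Proof. by move=> x y; rewrite !lt_neqAle ler_rc (inj_eq rc_inj). Qed.

Lemma rc_real r : rc r \is Num.real.
Proof.
by rewrite realE -(rmorph0 rc) !ler_rc; case: (leP 0 r) => // /ltW ->.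
Qed.

Lemma conj_rc r : (rc r)^* = rc r.
Proof. by apply/CrealP; exact: rc_real. Qed.

Lemma re_rc r : re (rc r) = r.
Proof. by apply: rc_inj; rewrite rc_re; apply/Creal_ReP; exact: rc_real. Qed.

Lemma reD z1 z2 : re (z1 + z2) = re z1 + re z2.
Proof. by apply: rc_inj; rewrite rmorphD /= !rc_re raddfD. Qed.

Lemma rc_reim z : z = rc (re z) + 'i * rc (im z).
Proof. by rewrite rc_re rc_im [LHS]Crect. Qed.

Definition cabs z : R := re `|z|.

Lemma cabsE z : `|z| = rc (cabs z).
Proof. by rewrite /cabs rc_re; apply/esym/Creal_ReP; exact: normr_real. Qed.

Lemma cabs_ge0 z : 0 <= cabs z.
Proof. by rewrite -ler_rc rmorph0 -cabsE. Qed.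

Lemma cabsM z1 z2 : cabs (z1 * z2) = cabs z1 * cabs z2.
Proof. by apply: rc_inj; rewrite -cabsE normrM !cabsE rmorphM. Qed.

Lemma cabsX z n : cabs (z ^+ n) = cabs z ^+ n.
Proof. by apply: rc_inj; rewrite -cabsE normrX !cabsE rmorphXn. Qed.

Lemma cabsN z : cabs (- z) = cabs z.
Proof. by rewrite /cabs normrN. Qed.

Lemma cabsD z1 z2 : cabs (z1 + z2) <= cabs z1 + cabs z2.
Proof. by rewrite -ler_rc rmorphD /= -!cabsE ler_normD. Qed.

Lemma cabs_rc r : cabs (rc r) = `|r|.
Proof.
apply: rc_inj; rewrite -cabsE; have [r0|/ltW r0] := leP 0 r.
  by rewrite !ger0_norm // -(rmorph0 rc) ler_rc.
by rewrite !ler0_norm ?rmorphN // -(rmorph0 rc) ler_rc.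
Qed.

Lemma cabs_nat n : cabs n%:R = n%:R.
Proof. by rewrite -(rmorph_nat rc) cabs_rc normr_nat. Qed.

Lemma cabs1 : cabs 1 = 1. Proof. exact: (cabs_nat 1). Qed.

Lemma cabs_i : cabs 'i = 1.
Proof. by apply: rc_inj; rewrite -cabsE normCi rmorph1. Qed.

Lemma cabs_sqr z : cabs z ^+ 2 = re z ^+ 2 + im z ^+ 2.
Proof.
by apply: rc_inj; rewrite rmorphXn /= -cabsE normC2_Re_Im rmorphD /= !rmorphXn /= rc_re rc_im.
Qed.

Lemma re_le_cabs z : `|re z| <= cabs z.
Proof.
rewrite -(ler_pXn2r (n := 2)) ?nnegrE ?cabs_ge0 // cabs_sqr real_normK ?num_real //.
by rewrite lerDl sqr_ge0.
Qed.

Lemma im_le_cabs z : `|im z| <= cabs z.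
Proof.
rewrite -(ler_pXn2r (n := 2)) ?nnegrE ?cabs_ge0 // cabs_sqr real_normK ?num_real //.
by rewrite lerDr sqr_ge0.
Qed.

Context {E : completeNormedModType C}.
Implicit Types x y : E.

Definition nrm x : R := re `|x|.

Lemma nrmE x : `|x| = rc (nrm x).
Proof. by rewrite /nrm rc_re; apply/esym/Creal_ReP; exact: normr_real. Qed.

Lemma nrm_ge0 x : 0 <= nrm x.
Proof. by rewrite -ler_rc rmorph0 -nrmE. Qed.

Lemma nrm0 : nrm 0 = 0.
Proof. by apply: rc_inj; rewrite -nrmE normr0 rmorph0. Qed.

Lemma nrm0_eq0 x : nrm x = 0 -> x = 0.
Proof. by move=> h; apply/normr0_eq0; rewrite nrmE h rmorph0. Qed.

Lemma nrmN x : nrm (- x) = nrm x.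
Proof. by rewrite /nrm normrN. Qed.

Lemma nrmD x y : nrm (x + y) <= nrm x + nrm y.
Proof. by rewrite -ler_rc rmorphD /= -!nrmE ler_normD. Qed.

Lemma nrmB x y : nrm (x - y) <= nrm x + nrm y.
Proof. by rewrite -(nrmN y) nrmD. Qed.

Lemma nrmZ (a : C) x : nrm (a *: x) = cabs a * nrm x.
Proof. by apply: rc_inj; rewrite -nrmE normrZ cabsE nrmE rmorphM. Qed.

Lemma nrm_le_scale n x c : (0 < n)%N -> nrm (n%:R *: x) <= n%:R * c -> nrm x <= c.
Proof. by move=> n0; rewrite nrmZ cabs_nat ler_pM2l ?ltr0n. Qed.

Lemma nrm_sum (I : Type) (s : seq I) (P : pred I) (F : I -> E) :
  nrm (\sum_(i <- s | P i) F i) <= \sum_(i <- s | P i) nrm (F i).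
Proof.
elim/big_rec2: _ => [|i a x _ h]; first by rewrite nrm0.
by apply: le_trans (nrmD _ _) _; rewrite lerD2l.
Qed.

Lemma cvg_nrm (f : nat -> E) (l : E) (g : nat -> R) :
  (forall n, nrm (f n - l) <= g n) -> (g @ \oo --> 0)%classic ->
  (f @ \oo --> l)%classic.
Proof.
move=> fg g0; apply/cvgrPdist_lt => e e0.
have eE : e = rc (re e) by rewrite rc_re; apply/esym/Creal_ReP/gtr0_real.
have re0 : 0 < re e by rewrite -ltr_rc rmorph0 -eE.
move/cvgrPdist_lt: g0 => /(_ _ re0) [n0 _ hn0].
exists n0 => // n /hn0 /=; rewrite sub0r normrN => lt.
rewrite nrmE eE ltr_rc -nrmN opprB.
by apply: le_lt_trans (fg n) _; apply: le_lt_trans lt; rewrite ler_norm.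
Qed.

Lemma nrm_lim_le (f : nat -> E) (l y : E) (c : R) (n0 : nat) :
  (f @ \oo --> l)%classic -> (forall n, (n0 <= n)%N -> nrm (f n - y) <= c) ->
  nrm (l - y) <= c.
Proof.
move=> fl h; apply/ler_addgt0Pr => e e0.
have /cvgrPdist_lt /(_ (rc e)) : (f @ \oo --> l)%classic by [].
rewrite -(rmorph0 rc) ltr_rc => /(_ e0) [n1 _ hn1].
have := hn1 (maxn n0 n1) (leq_maxr _ _); rewrite /= nrmE ltr_rc => /ltW le.
have := h (maxn n0 n1) (leq_maxl _ _) => le2.
have -> : l - y = (l - f (maxn n0 n1)) + (f (maxn n0 n1) - y) by rewrite addrA subrK.
by apply: le_trans (nrmD _ _) _; rewrite addrC lerD.
Qed.

End RealNorm.

(** * Exponentials of operators *)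

Section Exponential.
Context {R : realType} {C : numClosedFieldType} {RC : complexOver R C}.

Definition cis (t : R) : C := rc (cos t) + 'i * rc (sin t).

(** The sign of the imaginary part decides between [acos] and its opposite. *)
Lemma unit_cis (z : C) : cabs z = 1 -> exists t, z = cis t.
Proof.
move=> h.
have hab : re z ^+ 2 + im z ^+ 2 = 1 by rewrite -cabs_sqr h expr1n.
have a1 : -1 <= re z <= 1 by rewrite -ler_norml -[X in _ <= X]h re_le_cabs.
have sb : Num.sqrt (1 - re z ^+ 2) = `|im z| by rewrite -hab addrC addKr sqrtr_sqr.
have [b0|b0] := leP 0 (im z).
  by exists (acos (re z)); rewrite [LHS]rc_reim /cis acosK ?in_itv //= sin_acos // sb ger0_norm.
exists (- acos (re z)); rewrite [LHS]rc_reim /cis cosN sinN acosK ?in_itv //= sin_acos // sb.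
by rewrite ltr0_norm // opprK.
Qed.

Lemma cis_double t : cis (t + t) = cis t ^+ 2.
Proof.
rewrite /cis cosD sinD rmorphB rmorphD /= !rmorphM /=.
by have := @sqrCi C; move: 'i => J hJ; ring: hJ.
Qed.

Lemma exp_coeff_cis (t : R) k :
  ('i * rc t) ^+ k / k`!%:R = rc (cos_coeff t k) + 'i * rc (sin_coeff t k) :> C.
Proof.
have ik : 'i ^+ k = (~~ odd k)%:R * (-1) ^+ k./2 + 'i * ((odd k)%:R * (-1) ^+ k.-1./2) :> C.
  have sqm m : 'i ^+ (m.*2) = (-1) ^+ m :> C by rewrite -mul2n exprM sqrCi.
  rewrite -(odd_double_half k); case: (odd k); rewrite /= ?add1n ?add0n /= odd_double /=.
    by rewrite doubleK mul0r add0r exprS sqm mul1r.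
  by rewrite doubleK mul0r mulr0 addr0 mul1r sqm.
rewrite exprMn ik cos_coeffE sin_coeffE /= !rmorphM !rmorphV ?unitfE ?pnatr_eq0 -?lt0n ?fact_gt0 //=.
by rewrite !rmorphXn /= rmorphN1 !rmorph_nat; ring.
Qed.

Context {E : completeNormedModType C}.
Implicit Types (T : E -> E) (x : E).

Lemma cvg_exp_cis (t : R) (x : E) :
  (series (fun k => (('i * rc t) ^+ k / k`!%:R) *: x) @ \oo --> cis t *: x)%classic.
Proof.
pose g n := (`|series (cos_coeff t) n - cos t| + `|series (sin_coeff t) n - sin t|) * nrm (RC := RC) x.
have sE n : series (fun k => (('i * rc t) ^+ k / k`!%:R) *: x) n
    = (rc (series (cos_coeff t) n) + 'i * rc (series (sin_coeff t) n)) *: x.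
  rewrite /series /= -scaler_suml !rmorph_sum mulr_sumr -big_split /=; congr (_ *: _).
  by apply: eq_bigr => k _; exact: exp_coeff_cis.
apply: (@cvg_nrm _ _ _ _ (series (fun k => (('i * rc t) ^+ k / k`!%:R) *: x)) (cis t *: x) g) => [n|].
  rewrite sE -scalerBl nrmZ /g ler_wpM2r ?nrm_ge0 //.
  have -> : rc (series (cos_coeff t) n) + 'i * rc (series (sin_coeff t) n) - cis t
    = rc (series (cos_coeff t) n - cos t) + 'i * rc (series (sin_coeff t) n - sin t).
    by rewrite /cis !rmorphB /=; ring.
  by apply: le_trans (cabsD _ _) _; rewrite cabsM cabs_i mul1r !cabs_rc.
have cc : (series (cos_coeff t) @ \oo --> cos t)%classic.
  by rewrite cos.unlock; exact: is_cvg_series_cos_coeff.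
have cs : (series (sin_coeff t) @ \oo --> sin t)%classic.
  by rewrite sin.unlock; exact: is_cvg_series_sin_coeff.
have z (u : R^nat) (l : R) : (u @ \oo --> l)%classic ->
    ((fun n => `|u n - l|) @ \oo --> (0 : R))%classic.
  move=> ul; rewrite -[0 : R](@normr0 _ R) -(subrr l).
  by apply: cvg_norm; apply: cvgB => //; exact: cvg_cst.
rewrite -[0 : R](mul0r (nrm x)) -[0 : R]addr0.
by apply: cvgM; [apply: cvgD; exact: z|exact: cvg_cst].
Qed.

(** The vector [exp (i t T) x]. *)
Definition expi (t : R) T x : E :=
  limn (series (fun k : nat => (('i * rc t) ^+ k / k`!%:R) *: iter k T x)).

Lemma scaler_lincomb3 (a b c d : C) (x y z : E) :
  a *: (b *: x + c *: y + d *: z) = (a * b) *: x + (a * c) *: y + (a * d) *: z.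
Proof. by rewrite !scalerDr !scalerA. Qed.

Lemma expi_eigen T (t l0 l1 l2 : R) x0 x1 x2 :
  (forall x y, T (x + y) = T x + T y) -> (forall a x, T (a *: x) = a *: T x) ->
  T x0 = rc l0 *: x0 -> T x1 = rc l1 *: x1 -> T x2 = rc l2 *: x2 ->
  expi t T (x0 + x1 + x2)
  = cis (t * l0) *: x0 + cis (t * l1) *: x1 + cis (t * l2) *: x2.
Proof.
move=> TD TZ h0 h1 h2.
have itE k : iter k T (x0 + x1 + x2) = rc l0 ^+ k *: x0 + rc l1 ^+ k *: x1 + rc l2 ^+ k *: x2.
  elim: k => [|k IH]; first by rewrite /= !expr0 !scale1r.
  by rewrite iterS IH !TD !TZ h0 h1 h2 !scalerA -!exprSr.
rewrite /expi; apply/cvg_lim => //.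
pose s (l : R) x := series (fun k => (('i * rc (complexOver := RC) (t * l)) ^+ k / k`!%:R) *: x).
have -> : series (fun k => ('i * rc t) ^+ k / k`!%:R *: iter k T (x0 + x1 + x2))
    = (fun n => s l0 x0 n + s l1 x1 n + s l2 x2 n).
  apply/funext => n; rewrite /s /series /= -!big_split /=.
  have coefE (l : R) k : ('i * rc t) ^+ k / k`!%:R * rc l ^+ k
      = ('i * rc (t * l)) ^+ k / k`!%:R.
    by rewrite rmorphM /= mulrA [in RHS]exprMn mulrAC.
  by apply: eq_bigr => k _; rewrite itE scaler_lincomb3 !coefE.
by apply: cvgD; first apply: cvgD; exact: cvg_exp_cis.
Qed.

Lemma sum_exp_coeff_le (x : R) m n : 0 <= x ->
  \sum_(m <= k < n) exp_coeff x k <= expR x.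
Proof.
move=> x0.
have h : series (exp_coeff x) n <= expR x.
  apply: (nondecreasing_cvgn_le _ (is_cvg_series_exp_coeff x)).
  by apply: nondecreasing_series => i _ _; exact: exp_coeff_ge0.
apply: le_trans h; rewrite /series /=.
have [le|lt] := leqP m n.
  rewrite [leRHS](@big_cat_nat _ _ _ m) //= lerDr.
  by apply: sumr_ge0 => k _; exact: exp_coeff_ge0.
rewrite big_geq ?(ltnW lt) //.
by apply: sumr_ge0 => k _; exact: exp_coeff_ge0.
Qed.

(** The series is dominated in norm by that of [expR (t * M)]. *)
Lemma cvg_expi (t M : R) T x : 0 <= t -> 0 <= M ->
  (forall y, nrm (T y) <= M * nrm y) ->
  (series (fun k => (('i * rc t) ^+ k / k`!%:R) *: iter k T x) @ \oo --> expi t T x)%classic.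
Proof.
move=> t0 M0 hT.
pose u k := (('i * rc (complexOver := RC) t) ^+ k / k`!%:R) *: iter k T x.
have itb k : nrm (iter k T x) <= M ^+ k * nrm x.
  elim: k => [|k IH]; first by rewrite expr0 mul1r.
  by rewrite iterS exprS -mulrA; apply: le_trans (hT _) _; rewrite ler_wpM2l.
have ub k : nrm (u k) <= exp_coeff (t * M) k * nrm x.
  rewrite /u nrmZ exp_coeffE /= -(ler_pM2l (x := k`!%:R)) ?ltr0n ?fact_gt0 //.
  rewrite cabsM cabsX cabsM cabs_i mul1r cabs_rc ger0_norm //.
  have -> : cabs (k`!%:R^-1) = k`!%:R^-1 :> R.
    by rewrite -(rmorph_nat rc) -fmorphV cabs_rc ger0_norm // invr_ge0 ler0n.
  rewrite !mulrA [_ * t ^+ k]mulrC !mulfK ?mulVKf ?mulfV ?mul1r ?pnatr_eq0 -?lt0n ?fact_gt0 //.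
  by rewrite exprMn -mulrA ler_wpM2l // exprn_ge0.
suff : cvgn (series u) by [].
apply/cauchy_cvgP/cauchy_seriesP => e e0.
have eE : e = rc (re e) by rewrite rc_re; apply/esym/Creal_ReP/gtr0_real.
have re0 : 0 < re e by rewrite -ltr_rc rmorph0 -eE.
have : cauchy (series (exp_coeff (t * M)) @ \oo)%classic.
  by apply/cauchy_cvgP; exact: is_cvg_series_exp_coeff.
move/cauchy_seriesP => /(_ (re e / (nrm x + 1))) h.
have nx : 0 < nrm x + 1 by rewrite ltr_wpDl ?nrm_ge0.
move: h; rewrite divr_gt0 // => /(_ isT); apply: filterS => -[m n] /= h.
rewrite eE nrmE ltr_rc; apply: le_lt_trans (nrm_sum _ _ _) _.
apply: (@le_lt_trans _ _ (\sum_(m <= k < n) exp_coeff (t * M) k * (nrm x + 1))).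
  apply: ler_sum => k _; apply: le_trans (ub k) _.
  by rewrite ler_wpM2l ?lerDl // exp_coeff_ge0 // mulr_ge0.
rewrite -mulr_suml -ltr_pdivlMr //.
by apply: le_lt_trans h; exact: ler_norm.
Qed.

End Exponential.

(** Every term of order two or more factors through [T (T x)], so that the
    remainder is controlled by this vector and not by [x]. *)
Lemma expi_taylor2 {R : realType} {C : numClosedFieldType} {RC : complexOver R C}
    {E : completeNormedModType C} (t M : R) (T : E -> E) (x : E) :
  0 <= t -> 0 <= M -> (forall y, nrm (T y) <= M * nrm y) ->
  nrm (expi t T x - (x + ('i * rc t) *: T x)) <= t ^+ 2 * expR (t * M) * nrm (T (T x)).
Proof.
move=> t0 M0 hT.
have itb k : nrm (iter k T (T (T x))) <= M ^+ k * nrm (T (T x)).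
  elim: k => [|k IH]; first by rewrite expr0 mul1r.
  by rewrite iterS exprS -mulrA; apply: le_trans (hT _) _; rewrite ler_wpM2l.
apply: (nrm_lim_le (n0 := 2%N) (cvg_expi t0 M0 hT)) => -[|[|n]] // _.
rewrite /series /= big_ltn // big_ltn //= !expr0 !expr1 !fact0 !divr1 scale1r.
rewrite addrA [X in nrm X]addrC addKr !big_add1 /=.
apply: le_trans (nrm_sum _ _ _) _.
apply: (@le_trans _ _ (\sum_(0 <= k < n) (t ^+ 2 * nrm (T (T x))) * exp_coeff (t * M) k)).
  apply: ler_sum => k _; rewrite -!iterS !iterSr nrmZ cabsM cabsX cabsM cabs_i mul1r.
  rewrite cabs_rc ger0_norm // -(rmorph_nat rc) -fmorphV cabs_rc.
  rewrite ger0_norm ?invr_ge0 ?ler0n // exp_coeffE /= exprS exprS exprMn.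
  have fk : k.+2`!%:R^-1 <= k`!%:R^-1 :> R.
    by rewrite lef_pV2 ?posrE ?ltr0n ?fact_gt0 // ler_nat !factS mulnA leq_pmull.
  apply: (@le_trans _ _ (t * (t * t ^+ k) * k`!%:R^-1 * (M ^+ k * nrm (T (T x))))).
    apply: ler_pM => //; rewrite ?nrm_ge0 ?mulr_ge0 ?exprn_ge0 ?invr_ge0 ?ler0n //.
    by rewrite ler_wpM2l // !mulr_ge0 ?exprn_ge0.
  by apply: ler_eq; ring.
rewrite -mulr_sumr [leRHS]mulrAC ler_wpM2l ?mulr_ge0 ?exprn_ge0 ?nrm_ge0 //.
by apply: sum_exp_coeff_le; rewrite mulr_ge0.
Qed.

(** If [T x] were not small while [T (T x)] is, then [exp (i t T) x] would
    move away from [x] like [t * T x], which its isometry forbids for large [t]. *)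
Lemma isometric_exp_sqr_small {R : realType} (eps M B : R) : 0 < eps -> 0 < M -> 0 < B ->
  exists2 del : R, 0 < del &
  forall (C : numClosedFieldType) (RC : complexOver R C) (E : completeNormedModType C)
    (T : E -> E) (x : E),
    (forall y, nrm (T y) <= M * nrm y) -> (forall t, nrm (expi t T x) = nrm x) ->
    nrm x <= B -> nrm (T (T x)) <= del -> nrm (T x) <= eps.
Proof.
move=> e0 M0 B0; pose t := 4 * B / eps.
have t0 : 0 < t by rewrite divr_gt0 // mulr_gt0.
pose c := t ^+ 2 * expR (t * M).
have c0 : 0 < c by rewrite mulr_gt0 ?expR_gt0 ?exprn_gt0.
exists (2 * B / c); first by rewrite divr_gt0 // mulr_gt0.
move=> C RC E T x hT iso xB small.
have h := expi_taylor2 x (ltW t0) (ltW M0) hT.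
have h2 : nrm (('i * rc t) *: T x) = t * nrm (T x).
  by rewrite nrmZ cabsM cabs_i mul1r cabs_rc ger0_norm // ltW.
have E1 : ('i * rc t) *: T x = (expi t T x - x) - (expi t T x - (x + ('i * rc t) *: T x)).
  by rewrite opprB [RHS]addrC addrA subrK addrC addKr.
have le1 : t * nrm (T x) <= B + B + c * nrm (T (T x)).
  rewrite -h2 E1; apply: le_trans (nrmB _ _) _; apply: lerD h.
  by apply: le_trans (nrmB _ _) _; rewrite iso lerD.
have le2 : c * nrm (T (T x)) <= 2 * B by rewrite mulrC -ler_pdivlMr.
have tE : t * eps = 4 * B by rewrite divfK ?gt_eqF.
have le3 : t * nrm (T x) <= t * eps by rewrite tE; lra.
by rewrite ler_pM2l in le3.
Qed.

(** * Cauchy estimates and operators close to the identity *)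

Section Cauchy.
Context {R : realType} {C : numClosedFieldType} {RC : complexOver R C}.

(** A [2 ^ n]-th root [w] of [-1] is a primitive root of unity of order
    [2 ^ n.+1]. *)
Lemma root_of_unity_filter n : exists N (w : C),
  [/\ (n < N)%N, cabs w = 1, w ^+ N = 1 &
      forall k, ~~ (N %| k)%N -> \sum_(j < N) w ^+ (j * k) = 0].
Proof.
pose N := (2 ^ n.+1)%N; pose w : C := (2 ^ n)%N.-root (-1).
have wn : w ^+ (2 ^ n) = -1 by apply: rootCK; rewrite expn_gt0.
have wN : w ^+ N = 1 by rewrite /N expnSr exprM wn sqrrN expr1n.
have N0 : (0 < N)%N by rewrite expn_gt0.
exists N, w; split => //.
- by apply: ltn_trans (ltn_expl _ _); rewrite ?ltnS.
- apply/eqP; rewrite -(eqrXn2 (n := N)) ?cabs_ge0 //.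
  by rewrite -cabsX wN cabs1 expr1n.
move=> k Nk.
have wk : w ^+ k != 1.
  apply: contra Nk => /eqP wk; rewrite /dvdn; apply: contraT => r0.
  have r_gt0 : (0 < k %% N)%N by rewrite lt0n.
  have wr : w ^+ (k %% N) = 1 by rewrite (expr_mod k wN).
  (* If [w ^+ k = 1], raising to a power of [2] leaves an odd power of
     [w ^+ (2 ^ n) = -1]. *)
  have [m m2 rE] := pfactor_coprime (isT : prime 2) r_gt0.
  have a_le : (logn 2 (k %% N) <= n)%N.
    rewrite -ltnS -(ltn_exp2l (m := 2)) //.
    by apply: leq_ltn_trans (ltn_pmod k N0); rewrite dvdn_leq // pfactor_dvdnn.
  have : w ^+ ((k %% N) * 2 ^ (n - logn 2 (k %% N))) = 1 by rewrite exprM wr expr1n.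
  rewrite {1}rE -mulnA -expnD subnKC // mulnC exprM wn -signr_odd.
  rewrite coprime2n in m2; rewrite m2 expr1 => /eqP.
  by rewrite eq_sym -subr_eq0 opprK -(natrD _ 1 1) pnatr_eq0.
apply: (mulfI (_ : w ^+ k - 1 != 0)); first by rewrite subr_eq0.
rewrite mulr0; under eq_bigr => j _ do rewrite mulnC exprM.
by rewrite -subrX1 exprAC wN expr1n subrr.
Qed.

Context {E : completeNormedModType C}.

(** The coefficient of degree one is an average of the values on a circle,
    weighted by roots of unity. *)
Lemma cauchy_estimate (n : nat) (x : nat -> E) (r M : R) :
  0 <= r -> (forall z : C, cabs z = r -> nrm (\sum_(k < n.+2) z ^+ k *: x k) <= M) ->
  r * nrm (x 1%N) <= M.
Proof.
move=> r0 h; have [N [w [ltN w1 wN wsum]]] := root_of_unity_filter n.+2.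
have N0 : (0 < N)%N by apply: leq_ltn_trans ltN.
have key : \sum_(j < N) w ^+ (j * N.-1) *: (\sum_(k < n.+2) (rc r * w ^+ j) ^+ k *: x k)
    = (N%:R * rc r) *: x 1%N.
  under eq_bigr => j _ do rewrite scaler_sumr.
  rewrite exchange_big /= (bigD1 (lift ord0 ord0)) //= [X in _ + X]big1 ?addr0 => [|k k1].
    transitivity (\sum_(j < N) rc r *: x 1%N).
      apply: eq_bigr => j _; rewrite scalerA; congr (_ *: _).
      by rewrite expr1 mulrCA -exprD -mulnSr prednK // mulnC exprM wN expr1n mulr1.
    by rewrite sumr_const card_ord -scaler_nat scalerA.
  transitivity ((rc r ^+ k * \sum_(j < N) w ^+ (j * (N.-1 + k))) *: x k).
    rewrite mulr_sumr scaler_suml; apply: eq_bigr => j _.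
    by rewrite scalerA exprMn mulrCA -exprM -exprD -mulnDr.
  rewrite wsum ?mulr0 ?scale0r //; case: k k1 => -[|[|k]] //= kn _.
    by rewrite addn0 gtnNdvd ?prednK //; lia.
  rewrite -[(N.-1 + _)%N]/(N.-1 + k.+2)%N.
  have -> : (N.-1 + k.+2 = N + k.+1)%N by lia.
  by rewrite dvdn_addr // gtnNdvd //; lia.
have nN : 0 < N%:R :> R by rewrite ltr0n.
rewrite -(ler_pM2l nN) mulrA.
have -> : N%:R * r * nrm (x 1%N) = nrm ((N%:R * rc r) *: x 1%N).
  by rewrite nrmZ cabsM cabs_nat cabs_rc ger0_norm.
rewrite -key; apply: le_trans (nrm_sum _ _ _) _.
rewrite -[N in leRHS]card_ord mulr_natl -sumr_const; apply: ler_sum => j _.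
rewrite nrmZ cabsX w1 expr1n mul1r; apply: h.
by rewrite cabsM cabsX w1 expr1n mulr1 cabs_rc ger0_norm.
Qed.

Lemma iter_id_plus (B : E -> E) (z : C) n x :
  (forall y y', B (y + y') = B y + B y') -> (forall a y, B (a *: y) = a *: B y) ->
  iter n (fun y => y + z *: B y) x
  = \sum_(k < n.+1) z ^+ k *: ('C(n, k)%:R *: iter k B x).
Proof.
move=> BD BZ; have B0 : B 0 = 0 by rewrite -[X in B X](scale0r 0) BZ scale0r.
elim: n => [|n IH]; first by rewrite big_ord_recl big_ord0 /= !scale1r addr0.
rewrite iterS IH; rewrite (big_morph B BD B0) scaler_sumr.
rewrite big_ord_recl [RHS]big_ord_recl /= bin0 -!addrA; congr (_ + _).
rewrite [X in _ + X]big_ord_recr [RHS]big_ord_recr /= addrA.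
rewrite -[X in X + _ = _]big_split /=; congr (_ + _).
  apply: eq_bigr => k _; rewrite /bump /= !add1n.
  by rewrite !BZ !scalerA -scalerDl binS natrD exprS; congr (_ *: _); ring.
by rewrite !BZ !scalerA !binn /bump /= add1n exprS !mulr1.
Qed.

End Cauchy.

Section Smallness.
Context {R : realType} {C : numClosedFieldType} {RC : complexOver R C}.
Context {E : completeNormedModType C}.

Definition linear_op (B : E -> E) : Prop :=
  (forall x y, B (x + y) = B x + B y) /\ (forall a x, B (a *: x) = a *: B x).

Definition stable_subspace (F : E -> Prop) (B : E -> E) : Prop :=
  [/\ forall x y, F x -> F y -> F (x + y), forall a x, F x -> F (a *: x)
    & forall x, F x -> F (B x)].

Lemma linear_op0 B : linear_op B -> B 0 = 0.
Proof. by case=> _ BZ; rewrite -[X in B X](scale0r 0) BZ scale0r. Qed.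

Lemma nrm_iter_id_plus (F : E -> Prop) (B : E -> E) (z : C) (c : R) n x :
  stable_subspace F B -> 0 <= c ->
  (forall y, F y -> nrm (y + z *: B y) <= c * nrm y) -> F x ->
  nrm (iter n (fun y => y + z *: B y) x) <= c ^+ n * nrm x.
Proof.
move=> [FD FZ FB] c0 h Fx; have [] // : nrm (iter n (fun y => y + z *: B y) x) <= c ^+ n * nrm x
  /\ F (iter n (fun y => y + z *: B y) x).
elim: n => [|n [IH1 IH2]]; first by rewrite expr0 mul1r.
rewrite iterS; split; last by apply: FD => //; apply: FZ; apply: FB.
by apply: le_trans (h _ IH2) _; rewrite exprS -mulrA ler_wpM2l.
Qed.

Lemma nrm_le_pow (F : E -> Prop) (B : E -> E) (r c : R) n x :
  linear_op B -> stable_subspace F B -> 0 <= r -> 0 <= c ->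
  (forall z y, cabs z = r -> F y -> nrm (y + z *: B y) <= c * nrm y) -> F x ->
  n.+1%:R * r * nrm (B x) <= c ^+ n.+1 * nrm x.
Proof.
move=> [BD BZ] sF r0 c0 h Fx.
have -> : n.+1%:R * r * nrm (B x) = r * nrm ('C(n.+1, 1)%:R *: iter 1 B x).
  by rewrite bin1 nrmZ cabs_nat mulrCA mulrA.
apply: (@cauchy_estimate _ _ _ _ n (fun k => 'C(n.+1, k)%:R *: iter k B x)) => // z zr.
rewrite -iter_id_plus //; apply: nrm_iter_id_plus sF _ _ _ => // y.
exact: h.
Qed.

End Smallness.

(** With [n = q ^ 5] and [|z| = q ^- 4] the norm of [(1 + z B) ^ n] stays below
    [expR (1 + c)], whereas by Cauchy's estimate it bounds that of the linear
    term [n z B], which is [q] times that of [B]. The error [c * r ^+ 5], with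
    [|z| = r ^+ 4], covers all the error terms met below. *)
Lemma small_of_flat {R : realType} (eps c : R) : 0 < eps -> 0 <= c ->
  exists2 del : R, 0 < del & forall (C : numClosedFieldType) (RC : complexOver R C)
    (E : completeNormedModType C) (F : E -> Prop) (B : E -> E) (eta : R),
    linear_op B -> stable_subspace F B -> 0 <= eta <= del ->
    (forall r z x, 0 < r <= 2^-1 -> cabs z = r ^+ 4 -> F x ->
       nrm (x + z *: B x) <= (1 + eta + c * r ^+ 5) * nrm x) ->
    forall x, F x -> nrm (B x) <= eps * nrm x.
Proof.
move=> e0 c0.
pose q := (Num.bound (expR (1 + c) / eps)).+2.
have q0 : 0 < q%:R :> R by rewrite ltr0n.
have q2 : 2 <= q%:R :> R by rewrite ler_nat.
have qb : expR (1 + c) / eps <= q%:R.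
  apply: le_trans (ltW (archi_boundP _)) _; first by rewrite divr_ge0 ?expR_ge0 ?ltW.
  by rewrite ler_nat /q; apply: leqW; exact: leqnSn.
exists ((q%:R ^+ 5)^-1); first by rewrite invr_gt0 exprn_gt0.
move=> C RC E F B eta lB sF /andP[eta0 etad] h x Fx.
pose r : R := q%:R^-1.
have r0 : 0 < r by rewrite invr_gt0.
have r2 : r <= 2^-1 by rewrite lef_pV2 ?posrE.
pose n := (q ^ 5).-1; have nE : n.+1 = (q ^ 5)%N by rewrite prednK // expn_gt0.
pose k := 1 + eta + c * r ^+ 5.
have k0 : 0 <= k by rewrite !addr_ge0 // mulr_ge0 // exprn_ge0 // ltW.
have hk z y : cabs z = r ^+ 4 -> F y -> nrm (y + z *: B y) <= k * nrm y.
  by move=> zr Fy; apply: h => //; rewrite r0.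
have := nrm_le_pow n lB sF (exprn_ge0 4 (ltW r0)) k0 hk Fx.
have -> : n.+1%:R * r ^+ 4 = q%:R.
  by rewrite nE natrX /r exprVn exprS mulfK // expf_neq0 // gt_eqF.
have kle : k ^+ n.+1 <= expR (1 + c).
  have le1 : k <= expR (eta + c * r ^+ 5).
    by apply: le_trans (expR_ge1Dx _); rewrite addrA.
  apply: (@le_trans _ _ (expR (eta + c * r ^+ 5) ^+ n.+1)).
    by rewrite lerXn2r ?nnegrE ?expR_ge0.
  rewrite -expRM_natl ler_expR nE natrX mulrDr lerD //.
    by rewrite mulrC -ler_pdivlMr ?exprn_gt0 // mul1r.
  by rewrite mulrCA /r exprVn divff ?mulr1 // expf_neq0 // gt_eqF.
move=> le1.
have le2 : q%:R * nrm (B x) <= expR (1 + c) * nrm x.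
  by apply: le_trans le1 _; rewrite ler_wpM2r ?nrm_ge0.
rewrite -(ler_pM2l q0); apply: le_trans le2 _.
rewrite mulrA ler_wpM2r ?nrm_ge0 //.
by rewrite -ler_pdivrMr.
Qed.

Section Disc.
Context {R : realType} {C : numClosedFieldType} {RC : complexOver R C}.

Lemma imD (z1 z2 : C) : im (z1 + z2) = im z1 + im z2.
Proof. by apply: rc_inj; rewrite rmorphD /= !rc_im raddfD. Qed.

Lemma im_rc (r : R) : im (rc r) = 0.
Proof. by apply: rc_inj; rewrite rc_im rmorph0; apply/Creal_ImP; exact: rc_real. Qed.

Lemma re_irc (r : R) : re ('i * rc r) = 0.
Proof.
apply: rc_inj; rewrite rc_re rmorph0 -[X in 'Re X]add0r.
by rewrite Re_rect ?rpred0 // rc_real.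
Qed.

Lemma reN (z : C) : re (- z) = - re z.
Proof. by apply: rc_inj; rewrite rmorphN /= !rc_re raddfN. Qed.

Lemma imN (z : C) : im (- z) = - im z.
Proof. by apply: rc_inj; rewrite rmorphN /= !rc_im raddfN. Qed.

(** The disc of radius one about [1] contains a parabolic region tangent to
    the imaginary axis at [0]. *)
Lemma disc_shift (s : C) (rho : R) : cabs s = rho -> rho <= 1 -> 0 <= re s ->
  cabs (1 - (s + rc (rho ^+ 2))) <= 1.
Proof.
move=> srho rho1 re0.
have rho0 : 0 <= rho by rewrite -srho cabs_ge0.
rewrite -(ler_pXn2r (n := 2)) ?nnegrE ?cabs_ge0 // expr1n cabs_sqr.
rewrite -(rmorph1 rc) reD imD reN imN reD imD !re_rc !im_rc.
have := cabs_sqr (RC := RC) s; rewrite srho.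
have : 0 <= (1 - rho ^+ 2) by rewrite subr_ge0 expr_le1.
move: (re s) (im s) (rho ^+ 2) (sqr_ge0 rho) re0 => a b m m0 a0 m1 mE.
have p1 : 0 <= a * (1 - m) by rewrite mulr_ge0.
have p2 : 0 <= m * (1 - m) by rewrite mulr_ge0.
rewrite -subr_ge0.
have -> : 1 - ((1 - (a + m)) ^+ 2 + (0 - (b + 0)) ^+ 2)
  = 2 * (a * (1 - m)) + m * (1 - m) + (m - (a ^+ 2 + b ^+ 2)) by ring.
rewrite -mE subrr addr0; lra.
Qed.

Lemma sqrt_re_ge0 (z : C) : exists2 s : C, s ^+ 2 = z & 0 <= re s.
Proof.
have [h|/ltW h] := leP 0 (re (sqrtC z)); first by exists (sqrtC z); rewrite ?sqrtCK.
by exists (- sqrtC z); rewrite ?sqrrN ?sqrtCK // reN oppr_ge0.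
Qed.

Lemma root24_re_ge0 (m : nat) (z : C) : m = 2%N \/ m = 4%N ->
  exists2 s : C, s ^+ m = z & 0 <= re s.
Proof.
case=> ->; first exact: sqrt_re_ge0.
have [s1 s1E _] := sqrt_re_ge0 z; have [s sE s0] := sqrt_re_ge0 s1.
by exists s => //; rewrite -s1E -sE -exprM.
Qed.

Lemma cabs_shiftX (m : nat) (s : C) (rho : R) : m = 2%N \/ m = 4%N ->
  cabs s = rho -> rho <= 1 ->
  cabs ((s + rc (rho ^+ 2)) ^+ m - s ^+ m) <= 15 * rho ^+ m.+1.
Proof.
move=> m24 srho rho1; have rho0 : 0 <= rho by rewrite -srho cabs_ge0.
pose t := s + rc (complexOver := RC) (rho ^+ 2).
have rr : rho ^+ 2 <= rho by rewrite expr2 ler_piMl.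
have crr : cabs (rc (rho ^+ 2)) = rho ^+ 2 by rewrite cabs_rc ger0_norm ?exprn_ge0.
have ct : cabs t <= 2 * rho.
  by apply: le_trans (cabsD _ _) _; rewrite srho crr; lra.
have c2 : cabs (t ^+ 2 - s ^+ 2) <= 3 * rho ^+ 3.
  have -> : t ^+ 2 - s ^+ 2 = rc (rho ^+ 2) * (t + s) by rewrite /t; ring.
  have -> : 3 * rho ^+ 3 = rho ^+ 2 * (3 * rho) by ring.
  rewrite cabsM crr ler_wpM2l ?exprn_ge0 //.
  by apply: le_trans (cabsD _ _) _; rewrite srho; lra.
case: m24 => ->.
  by apply: le_trans c2 _; rewrite ler_wpM2r ?exprn_ge0 // ler_nat.
have -> : t ^+ 4 - s ^+ 4 = (t ^+ 2 - s ^+ 2) * (t ^+ 2 + s ^+ 2) by ring.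
have -> : 15 * rho ^+ 5 = (3 * rho ^+ 3) * (5 * rho ^+ 2) by ring.
rewrite cabsM ler_pM ?cabs_ge0 //; apply: le_trans (cabsD _ _) _.
have -> : 5 * rho ^+ 2 = (2 * rho) ^+ 2 + rho ^+ 2 by ring.
by rewrite !cabsX srho lerD2r lerXn2r ?nnegrE ?cabs_ge0 ?mulr_ge0.
Qed.

End Disc.

(** Near its boundary point [0] the disc [|1 - s| <= 1] is almost a half-plane,
    on which [s ^ m] takes all arguments since [m >= 2]: a root [s] of [z] with
    nonnegative real part lies in the disc after a shift by [|s| ^ 2], which
    changes [s ^ m] by a term of higher order. *)
Lemma small_of_cusp {R : realType} (eps M : R) (m : nat) :
  m = 2%N \/ m = 4%N -> 0 < eps -> 0 <= M ->
  exists2 del : R, 0 < del & forall (C : numClosedFieldType) (RC : complexOver R C)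
    (E : completeNormedModType C) (F : E -> Prop) (B : E -> E) (eta : R),
    linear_op B -> stable_subspace F B -> 0 <= eta <= del ->
    (forall x, F x -> nrm (B x) <= M * nrm x) ->
    (forall s x, cabs (1 - s) <= 1 -> F x ->
       nrm (x + s ^+ m *: B x) <= (1 + eta) * nrm x) ->
    forall x, F x -> nrm (B x) <= eps * nrm x.
Proof.
move=> m24 e0 M0.
have [|del del0 hdel] := @small_of_flat R eps (15 * M) e0; first by rewrite mulr_ge0.
exists del => // C RC E F B eta lB sF etab BM h x Fx.
apply: (hdel C RC E F B eta) => // {x Fx} r z x /andP[r0 r2] zr Fx.
have r1 : r <= 1 by apply: le_trans r2 _; rewrite invf_le1 // ler1n.
have [s sz s0] := root24_re_ge0 (RC := RC) z m24.
have [rho [rhoE rho1 rho5]] : exists rho, [/\ cabs s = rho, rho <= 1 & rho ^+ m.+1 <= r ^+ 5].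
  exists (cabs s); have : cabs s ^+ m = r ^+ 4 by rewrite -cabsX sz.
  case: m24 => -> cE.
    have -> : cabs s = r ^+ 2.
      by apply/eqP; rewrite -(eqrXn2 (n := 2)) ?cabs_ge0 ?exprn_ge0 ?(ltW r0) // cE -exprM.
    by rewrite expr_le1 ?(ltW r0) // -exprM; split=> //; rewrite ler_wiXn2l // ltW.
  have -> : cabs s = r.
    by apply/eqP; rewrite -(eqrXn2 (n := 4)) ?cabs_ge0 ?(ltW r0) // cE.
  by [].
have hs := h (s + rc (rho ^+ 2)) x (disc_shift rhoE rho1 s0) Fx.
have hc := cabs_shiftX m24 rhoE rho1.
pose t := (s + rc (complexOver := RC) (rho ^+ 2)) ^+ m.
have -> : x + z *: B x = (x + t *: B x) - (t - z) *: B x by lmod.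
apply: le_trans (nrmB _ _) _; rewrite mulrDl; apply: lerD => //.
rewrite nrmZ; apply: (@le_trans _ _ ((15 * r ^+ 5) * (M * nrm x))).
  rewrite ler_pM ?cabs_ge0 ?nrm_ge0 ?BM // -sz; apply: le_trans hc _.
  by rewrite ler_pM2l.
by apply: ler_eq; ring.
Qed.

(** For [m = 1] the disc only yields the directions [- s] of nonpositive real
    part. The bound on [x + K x] gives the positive real direction by convexity,
    and any [z] is the mean of [2 re z] and [2 'i im z]. *)
Lemma small_of_halfplane {R : realType} (eps M : R) : 0 < eps -> 0 <= M ->
  exists2 del : R, 0 < del & forall (C : numClosedFieldType) (RC : complexOver R C)
    (E : completeNormedModType C) (F : E -> Prop) (K A : E -> E) (eta : R),
    linear_op K -> stable_subspace F K -> 0 <= eta <= del ->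
    (forall x, F x -> nrm (K x) <= M * nrm x) ->
    (forall x, F x -> nrm (A x) <= M * nrm x) ->
    (forall s x, cabs (1 - s) <= 1 -> F x ->
       nrm (x - (2 * s) *: K x + s ^+ 2 *: A x) <= nrm x) ->
    (forall x, F x -> nrm (x + K x) <= (1 + eta) * nrm x) ->
    forall x, F x -> nrm (K x) <= eps * nrm x.
Proof.
move=> e0 M0.
have [|del del0 hdel] := @small_of_flat R eps (6 * M) e0; first by rewrite mulr_ge0.
exists del => // C RC E F K A eta lK sF etab KM AM hs hK x Fx.
have eta0 : 0 <= eta by case/andP: etab.
have half (s : C) y : 0 <= re s -> cabs s <= 1 -> F y ->
    nrm (y - (2 * s) *: K y) <= (1 + 6 * M * cabs s ^+ 2) * nrm y.
  move=> s0 s1 Fy; pose rho := cabs (RC := RC) s; pose t := s + rc (complexOver := RC) (rho ^+ 2).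
  have rho0 : 0 <= rho by exact: cabs_ge0.
  have ht := hs t y (disc_shift (erefl rho) s1 s0) Fy.
  have crr : cabs (rc (rho ^+ 2)) = rho ^+ 2 by rewrite cabs_rc ger0_norm ?exprn_ge0.
  have ct : cabs t <= 2 * rho.
    apply: le_trans (cabsD _ _) _; rewrite crr -/rho.
    have : rho ^+ 2 <= rho by rewrite expr2 ler_piMl.
    lra.
  have ct2 : cabs (t ^+ 2) <= 4 * rho ^+ 2.
    have -> : 4 * rho ^+ 2 = (2 * rho) ^+ 2 by ring.
    by rewrite cabsX lerXn2r ?nnegrE ?cabs_ge0 ?mulr_ge0.
  have -> : y - (2 * s) *: K y
      = (y - (2 * t) *: K y + t ^+ 2 *: A y) + ((2 * rc (rho ^+ 2)) *: K y - t ^+ 2 *: A y).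
    by rewrite /t; lmod.
  apply: le_trans (nrmD _ _) _; rewrite [leRHS]mulrDl mul1r; apply: lerD => //.
  apply: le_trans (nrmB _ _) _; rewrite !nrmZ cabsM crr cabs_nat.
  have h1 : 2 * rho ^+ 2 * nrm (K y) <= 2 * rho ^+ 2 * (M * nrm y).
    by rewrite ler_wpM2l ?KM // mulr_ge0 // exprn_ge0.
  have h2 : cabs (t ^+ 2) * nrm (A y) <= 4 * rho ^+ 2 * (M * nrm y).
    by rewrite ler_pM ?cabs_ge0 ?nrm_ge0 ?AM.
  apply: le_trans (lerD h1 h2) _; rewrite -/rho.
  by apply: ler_eq; ring.
apply: (hdel C RC E F K eta) => // {x Fx} r z x /andP[r0 r2] zr Fx.
have r4 : r ^+ 4 <= 2^-1.
  apply: le_trans (r2); rewrite -[leRHS]expr1 ler_wiXn2l ?ltW //.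
  by apply: le_lt_trans r2 _; rewrite invf_lt1 // ltr1n.
have rez := re_le_cabs (RC := RC) z; have imz := im_le_cabs (RC := RC) z; rewrite zr in rez imz.
have r8 : (r ^+ 4) ^+ 2 <= r ^+ 5.
  rewrite -exprM ler_wiXn2l ?(ltW r0) //.
  by apply: le_trans r2 _; rewrite invf_le1 // ler1n.
have sq (a : R) : `|a| <= r ^+ 4 -> 6 * M * `|a| ^+ 2 <= 6 * M * r ^+ 5.
  move=> a4; rewrite ler_wpM2l ?mulr_ge0 //; apply: le_trans r8.
  by rewrite lerXn2r ?nnegrE ?exprn_ge0 ?(ltW r0).
have r5 : 0 <= 6 * M * r ^+ 5 by rewrite !mulr_ge0 ?exprn_ge0 ?(ltW r0).
have part_im : nrm (x - (2 * (- 'i * rc (im z))) *: K x) <= (1 + eta + 6 * M * r ^+ 5) * nrm x.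
  have cE : cabs (- 'i * rc (im z)) = `|im z| by rewrite cabsM cabsN cabs_i mul1r cabs_rc.
  apply: le_trans (half _ x _ _ Fx) _; rewrite ?cE.
  - by rewrite mulNr reN re_irc oppr0.
  - by apply: le_trans imz _; apply: le_trans r4 _; rewrite invf_le1 // ler1n.
  - by rewrite ler_wpM2r ?nrm_ge0 //; have := sq _ imz; lra.
have part_re : nrm (x - (2 * rc (- re z)) *: K x) <= (1 + eta + 6 * M * r ^+ 5) * nrm x.
  have [p0|/ltW p0] := leP (re z) 0.
    apply: le_trans (half _ x _ _ Fx) _; rewrite ?re_rc ?oppr_ge0 // cabs_rc normrN.
      by apply: le_trans rez _; apply: le_trans r4 _; rewrite invf_le1 // ler1n.
    by rewrite ler_wpM2r ?nrm_ge0 //; have := sq _ rez; lra.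
  rewrite ger0_norm // in rez.
  have -> : x - (2 * rc (- re z)) *: K x
      = rc (1 - 2 * re z) *: x + rc (2 * re z) *: (x + K x).
    by rewrite !rmorphN rmorphB rmorphM rmorph1 rmorph_nat; lmod.
  have p1 : 0 <= 1 - 2 * re z by lra.
  have p2 : 0 <= 2 * re z by lra.
  apply: le_trans (nrmD _ _) _; rewrite !nrmZ !cabs_rc !ger0_norm //.
  have h1 : 2 * re z * nrm (x + K x) <= 2 * re z * ((1 + eta) * nrm x).
    by rewrite ler_wpM2l ?hK // mulr_ge0.
  apply: le_trans (_ : (1 + 2 * re z * eta) * nrm x <= _).
    apply: le_trans (lerD (lexx _) h1) _.
    by apply: ler_eq; ring.
  rewrite ler_wpM2r ?nrm_ge0 //.
  have : 2 * re z * eta <= eta by rewrite ler_piMl //; lra.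
  lra.
have E2 : 2 *: (x + z *: K x)
    = (x - (2 * rc (- re z)) *: K x) + (x - (2 * (- 'i * rc (im z))) *: K x).
  by rewrite [z in LHS]rc_reim rmorphN; lmod.
have : nrm (2 *: (x + z *: K x)) <= 2 * ((1 + eta + 6 * M * r ^+ 5) * nrm x).
  by rewrite E2; apply: le_trans (nrmD _ _) _; lra.
by rewrite nrmZ cabs_nat ler_pM2l.
Qed.

(** * Peirce calculus of a tripotent *)

Section JordanTriple.
Variables (C : numClosedFieldType) (E : lmodType C) (tp : E -> E -> E -> E).

Record jordan_triple : Prop := JordanTriple {
  tp_sym : forall x y z, tp x y z = tp z y x;
  tpDl : forall x x' y z, tp (x + x') y z = tp x y z + tp x' y z;
  tpZl : forall a x y z, tp (a *: x) y z = a *: tp x y z;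
  tpDm : forall x y y' z, tp x (y + y') z = tp x y z + tp x y' z;
  tpZm : forall a x y z, tp x (a *: y) z = a^* *: tp x y z;
  tp_jordan : forall x y a b c,
    tp x y (tp a b c) = tp (tp x y a) b c - tp a (tp y x b) c + tp a b (tp x y c)
}.

Hypothesis JT : jordan_triple.
Local Notation sym := (tp_sym JT).
Local Notation jordan := (tp_jordan JT).

Lemma tpDr x y z z' : tp x y (z + z') = tp x y z + tp x y z'.
Proof. by rewrite sym (tpDl JT) !(sym _ _ x). Qed.

Lemma tpZr a x y z : tp x y (a *: z) = a *: tp x y z.
Proof. by rewrite sym (tpZl JT) sym. Qed.

Lemma tpNr x y z : tp x y (- z) = - tp x y z.
Proof. by rewrite -scaleN1r tpZr scaleN1r. Qed.

Lemma tpBr x y z z' : tp x y (z - z') = tp x y z - tp x y z'.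
Proof. by rewrite tpDr tpNr. Qed.

Lemma tp0r x y : tp x y 0 = 0.
Proof. by rewrite -(scale0r (0 : E)) tpZr !scale0r. Qed.

Lemma tp0l y z : tp 0 y z = 0.
Proof. by rewrite sym tp0r. Qed.

Lemma tp0m x z : tp x 0 z = 0.
Proof. by rewrite -(scale0r (0 : E)) (tpZm JT) conjC0 !scale0r. Qed.

Lemma tpZm_nat n x y z : tp x (n%:R *: y) z = n%:R *: tp x y z.
Proof. by rewrite (tpZm JT) conjC_nat. Qed.

Definition Peirce2 (u x : E) : E := 2 *: tp u u (tp u u x) - tp u u x.
Definition Peirce1 (u x : E) : E := 4 *: (tp u u x - tp u u (tp u u x)).
Definition Peirce0 (u x : E) : E := x - 3 *: tp u u x + 2 *: tp u u (tp u u x).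

(** The factor [2] makes the Peirce indices [0], [1], [2] the eigenvalues. *)
Definition eig (u : E) (k : C) (x : E) : Prop := 2 *: tp u u x = k *: x.

Lemma Peirce_sum u x : Peirce0 u x + Peirce1 u x + Peirce2 u x = x.
Proof. by rewrite /Peirce0 /Peirce1 /Peirce2; lmod. Qed.

Lemma scaler2_inj (x y : E) : 2 *: x = 2 *: y :> E -> x = y.
Proof. by apply: scalerI; rewrite pnatr_eq0. Qed.

Lemma eq0_scale (k : C) (x : E) : k != 0 -> k *: x = 0 -> x = 0.
Proof. by move=> k0 /eqP; rewrite scaler_eq0 (negPf k0) => /eqP. Qed.

Section Tripotent.
Variable u : E.
Hypothesis uuu : tp u u u = u.
Local Notation T := (tp u u).
Local Notation Q x := (tp u x u).

(** The Jordan identity expresses [T Q] and [Q T] by each other in two ways. *)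
Lemma tripotent_Q_absorb x : T (Q x) = Q x.
Proof.
have h1 : T (Q x) = 2 *: Q x - Q (T x).
  by rewrite jordan uuu; lmod.
have h2 : Q x = 2 *: T (Q x) - Q (T x).
  by rewrite -[in LHS]uuu jordan uuu (sym x u u) (sym _ u u); lmod.
have h3 : 3 *: T (Q x) = 3 *: Q x.
  have -> : 3 *: T (Q x) = 2 *: T (Q x) + T (Q x) by lmod.
  by rewrite {2}h1; move: h2; set a := 2 *: T _ => ->; lmod.
by apply: scalerI h3; rewrite pnatr_eq0.
Qed.

Lemma tripotent_Q_sqr x : Q (Q x) = Peirce2 u x.
Proof.
have h : T x = 2 *: T (T x) - Q (Q x).
  have := jordan x u u u u; rewrite uuu (sym x u u) (sym (T x) u u) => {1}->.
  by lmod.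
by rewrite /Peirce2 {2}h; lmod.
Qed.

(** [T Q = Q] and [Q^2 = 2 T^2 - T] give [T (2 T^2 - T) = 2 T^2 - T]. *)
Lemma tripotent_cubic x : 2 *: T (T (T x)) = 3 *: T (T x) - T x.
Proof.
have : T (Peirce2 u x) = Peirce2 u x by rewrite -tripotent_Q_sqr tripotent_Q_absorb.
rewrite /Peirce2 tpBr tpZr => h.
have -> : 2 *: T (T (T x)) = (2 *: T (T (T x)) - T (T x)) + T (T x) by lmod.
by rewrite h; lmod.
Qed.

Lemma eig_u : eig u 2 u.
Proof. by rewrite /eig uuu. Qed.

Lemma eig_Peirce2 x : eig u 2 (Peirce2 u x).
Proof.
rewrite /eig /Peirce2 tpBr tpZr tripotent_cubic; lmod.
Qed.

Lemma eig_Peirce1 x : eig u 1 (Peirce1 u x).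
Proof.
rewrite /eig /Peirce1 tpZr tpBr.
have -> : 2 *: (4 *: (T (T x) - T (T (T x)))) = 8 *: T (T x) - 4 *: (2 *: T (T (T x))) by lmod.
by rewrite tripotent_cubic; lmod.
Qed.

Lemma eig_Peirce0 x : eig u 0 (Peirce0 u x).
Proof.
rewrite /eig /Peirce0 tpDr tpBr !tpZr tripotent_cubic.
by lmod.
Qed.

Lemma eig_sqr k x : eig u k x -> 4 *: T (T x) = k ^+ 2 *: x.
Proof.
move=> h; have -> : 4 *: T (T x) = 2 *: T (2 *: T x) by rewrite tpZr; lmod.
have hk : 2 *: (k *: T x) = k *: (2 *: T x) by lmod.
by rewrite h tpZr hk h; lmod.
Qed.

Lemma eig_eq0 k x : eig u k x -> k * (k - 1) * (k - 2) != 0 -> x = 0.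
Proof.
move=> h k0; apply: (eq0_scale k0).
have h2 := eig_sqr h; have h3 : 8 *: T (T (T x)) = k ^+ 3 *: x.
  have -> : 8 *: T (T (T x)) = 2 *: T (4 *: T (T x)) by rewrite tpZr; lmod.
  have hk : 2 *: (k ^+ 2 *: T x) = k ^+ 2 *: (2 *: T x) by lmod.
  by rewrite h2 tpZr hk h; lmod.
have h4 := tripotent_cubic x.
have -> : k * (k - 1) * (k - 2) *: x = k ^+ 3 *: x - 3 *: (k ^+ 2 *: x) + 2 *: (k *: x) by lmod.
rewrite -h -h2 -h3.
have -> : 8 *: T (T (T x)) = 4 *: (2 *: T (T (T x))) by lmod.
by rewrite h4; lmod.
Qed.

Lemma eig_Peirce2E k x : eig u k x -> 2 *: Peirce2 u x = (k * (k - 1)) *: x.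
Proof.
move=> h; have h2 := eig_sqr h.
have -> : 2 *: Peirce2 u x = 4 *: T (T x) - 2 *: T x by rewrite /Peirce2; lmod.
by rewrite h h2; lmod.
Qed.

Lemma eig_Peirce1E k x : eig u k x -> Peirce1 u x = (k * (2 - k)) *: x.
Proof.
move=> h; have h2 := eig_sqr h.
have -> : Peirce1 u x = 2 *: (2 *: T x) - 4 *: T (T x) by rewrite /Peirce1; lmod.
by rewrite h h2; lmod.
Qed.

Lemma eig_Peirce0E k x : eig u k x -> 2 *: Peirce0 u x = ((1 - k) * (2 - k)) *: x.
Proof.
move=> h; have h2 := eig_sqr h.
have -> : 2 *: Peirce0 u x = 2 *: x - 3 *: (2 *: T x) + 4 *: T (T x) by rewrite /Peirce0; lmod.
by rewrite h h2; lmod.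
Qed.

Lemma Peirce2_id x : eig u 2 x -> Peirce2 u x = x.
Proof. by move=> /eig_Peirce2E h; apply: scaler2_inj; rewrite h; lmod. Qed.

Lemma Peirce2_eq0 k x : eig u k x -> k * (k - 1) = 0 -> Peirce2 u x = 0.
Proof.
move=> /eig_Peirce2E h k0; apply: scaler2_inj.
by rewrite h k0 scale0r scaler0.
Qed.

Lemma Peirce1_id x : eig u 1 x -> Peirce1 u x = x.
Proof. by move=> /eig_Peirce1E ->; lmod. Qed.

Lemma Peirce1_eq0 k x : eig u k x -> k * (2 - k) = 0 -> Peirce1 u x = 0.
Proof. by move=> /eig_Peirce1E -> ->; rewrite scale0r. Qed.

Lemma Peirce0_id x : eig u 0 x -> Peirce0 u x = x.
Proof. by move=> /eig_Peirce0E h; apply: scaler2_inj; rewrite h; lmod. Qed.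

Lemma Peirce0_eq0 k x : eig u k x -> (1 - k) * (2 - k) = 0 -> Peirce0 u x = 0.
Proof.
move=> /eig_Peirce0E h k0; apply: scaler2_inj.
by rewrite h k0 scale0r scaler0.
Qed.

(** The Peirce rule: by the Jordan identity [L(u, u)] acts as a derivation, with
    a minus sign in the middle variable. *)
Lemma eig_tp (i j k l : C) a b c :
  eig u i a -> eig u j b -> eig u k c -> j^* = j -> l = i - j + k -> eig u l (tp a b c).
Proof.
move=> ha hb hc jr ->; rewrite /eig jordan.
have -> : 2 *: (tp (T a) b c - tp a (T b) c + tp a b (T c))
    = tp (2 *: T a) b c - tp a (2 *: T b) c + tp a b (2 *: T c).
  by rewrite (tpZl JT) tpZm_nat tpZr; lmod.
by rewrite ha hb hc (tpZl JT) (tpZm JT) tpZr jr; lmod.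
Qed.

Lemma eig_tp_nil (i j k : C) a b c :
  eig u i a -> eig u j b -> eig u k c -> j^* = j ->
  (i - j + k) * (i - j + k - 1) * (i - j + k - 2) != 0 -> tp a b c = 0.
Proof. by move=> ha hb hc jr; apply: eig_eq0; exact: eig_tp ha hb hc jr _. Qed.

Lemma Peirce_split (f g : E -> E) :
  (forall x y, f (x + y) = f x + f y) -> (forall x y, g (x + y) = g x + g y) ->
  (forall x, eig u 0 x -> f x = g x) -> (forall x, eig u 1 x -> f x = g x) ->
  (forall x, eig u 2 x -> f x = g x) -> forall x, f x = g x.
Proof.
move=> fD gD h0 h1 h2 x; rewrite -(Peirce_sum u x) 2!fD 2!gD.
by rewrite (h0 _ (eig_Peirce0 x)) (h1 _ (eig_Peirce1 x)) (h2 _ (eig_Peirce2 x)).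
Qed.

Lemma neq0_4 : (2 - 0 + 2 : C) * (2 - 0 + 2 - 1) * (2 - 0 + 2 - 2) != 0.
Proof.
have -> : (2 - 0 + 2 : C) * (2 - 0 + 2 - 1) * (2 - 0 + 2 - 2) = 24%:R by ring.
by rewrite ?oppr_eq0 pnatr_eq0.
Qed.

Lemma neq0_3 : (2 - 0 + 1 : C) * (2 - 0 + 1 - 1) * (2 - 0 + 1 - 2) != 0.
Proof.
have -> : (2 - 0 + 1 : C) * (2 - 0 + 1 - 1) * (2 - 0 + 1 - 2) = 6%:R by ring.
by rewrite ?oppr_eq0 pnatr_eq0.
Qed.

Lemma neq0_neg1 : (0 - 2 + 1 : C) * (0 - 2 + 1 - 1) * (0 - 2 + 1 - 2) != 0.
Proof.
have -> : (0 - 2 + 1 : C) * (0 - 2 + 1 - 1) * (0 - 2 + 1 - 2) = - 6%:R by ring.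
by rewrite ?oppr_eq0 pnatr_eq0.
Qed.

Lemma neq0_neg2 : (0 - 2 + 0 : C) * (0 - 2 + 0 - 1) * (0 - 2 + 0 - 2) != 0.
Proof.
have -> : (0 - 2 + 0 : C) * (0 - 2 + 0 - 1) * (0 - 2 + 0 - 2) = - 24%:R by ring.
by rewrite ?oppr_eq0 pnatr_eq0.
Qed.

(** The Peirce rule leaves only [x] in the Peirce-0 space; there the Jordan
    identity for [L(u, c)] applied to [{u,u,x} = 0] shows that
    [L(u, u) {u,c,x} = 0], although [{u,c,x}] has index [2]. *)
Lemma tp_u_Peirce0 c x : eig u 0 c -> tp u c x = 0.
Proof.
move=> hc; have Tc : T c = 0 by apply: scaler2_inj; rewrite hc scale0r scaler0.
move: x; apply: (@Peirce_split _ (fun=> 0)) => [x y|x y|x hx|x hx|x hx].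
- by rewrite tpDr.
- by rewrite addr0.
- have Tx : T x = 0 by apply: scaler2_inj; rewrite hx scale0r scaler0.
  have e2 : eig u 2 (tp u c x).
    by apply: (eig_tp eig_u hc hx); rewrite ?conjC0 //; ring.
  have ucu : tp u c u = 0.
    by apply: (eig_tp_nil eig_u hc eig_u); rewrite ?conjC0 // neq0_4.
  have := jordan u c u u x.
  rewrite Tx tp0r ucu tp0l (sym c u u) Tc tp0m subrr add0r => h.
  by apply: scaler2_inj; rewrite -e2 -h scaler0.
- by apply: (eig_tp_nil eig_u hc hx); rewrite ?conjC0 // neq0_3.
- by apply: (eig_tp_nil eig_u hc hx); rewrite ?conjC0 // neq0_4.
Qed.

(** Here only [x] in the Peirce-2 space is left, where [x = Q(u) Q(u) x]. *)
Lemma tp_Peirce0_u c x : eig u 0 c -> tp c u x = 0.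
Proof.
move=> hc; have Tc : T c = 0 by apply: scaler2_inj; rewrite hc scale0r scaler0.
move: x; apply: (@Peirce_split _ (fun=> 0)) => [x y|x y|x hx|x hx|x hx].
- by rewrite tpDr.
- by rewrite addr0.
- by apply: (eig_tp_nil hc eig_u hx); rewrite ?conjC_nat // neq0_neg2.
- by apply: (eig_tp_nil hc eig_u hx); rewrite ?conjC_nat // neq0_neg1.
rewrite -(Peirce2_id hx) -tripotent_Q_sqr jordan.
by rewrite (sym c u u) Tc tp0l (tp_u_Peirce0 _ hc) tp0m tp0r subrr add0r.
Qed.

End Tripotent.
End JordanTriple.

(** * Blocks of [L(v,v)] with respect to [u] *)

Section Blocks.
Variables (C : numClosedFieldType) (E : lmodType C) (tp : E -> E -> E -> E).
Hypothesis JT : jordan_triple tp.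
Local Notation sym := (tp_sym JT).
Local Notation jordan := (tp_jordan JT).
Variables u v : E.
Hypothesis uuu : tp u u u = u.
Local Notation T := (tp u u).
Local Notation S := (tp v v).
Local Notation P2 := (Peirce2 tp u).
Local Notation P1 := (Peirce1 tp u).
Local Notation P0 := (Peirce0 tp u).
Local Notation eig := (eig tp u).

Lemma Peirce2D a b : P2 (a + b) = P2 a + P2 b.
Proof. by rewrite /Peirce2 !(tpDr JT); lmod. Qed.
Lemma Peirce1D a b : P1 (a + b) = P1 a + P1 b.
Proof. by rewrite /Peirce1 !(tpDr JT); lmod. Qed.
Lemma Peirce0D a b : P0 (a + b) = P0 a + P0 b.
Proof. by rewrite /Peirce0 !(tpDr JT); lmod. Qed.
Lemma Peirce2Z k a : P2 (k *: a) = k *: P2 a.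
Proof. by rewrite /Peirce2 !(tpZr JT); lmod. Qed.
Lemma Peirce1Z k a : P1 (k *: a) = k *: P1 a.
Proof. by rewrite /Peirce1 !(tpZr JT); lmod. Qed.
Lemma Peirce0Z k a : P0 (k *: a) = k *: P0 a.
Proof. by rewrite /Peirce0 !(tpZr JT); lmod. Qed.
Lemma Peirce2N a : P2 (- a) = - P2 a.
Proof. by rewrite -scaleN1r Peirce2Z scaleN1r. Qed.
Lemma Peirce1N a : P1 (- a) = - P1 a.
Proof. by rewrite -scaleN1r Peirce1Z scaleN1r. Qed.
Lemma Peirce0N a : P0 (- a) = - P0 a.
Proof. by rewrite -scaleN1r Peirce0Z scaleN1r. Qed.

Lemma Peirce2T a : P2 (T a) = P2 a.
Proof.
rewrite /Peirce2 (tripotent_cubic JT uuu); lmod.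
Qed.

Lemma Peirce1T a : 2 *: P1 (T a) = P1 a.
Proof.
rewrite /Peirce1.
have -> : 2 *: (4 *: (T (T a) - T (T (T a)))) = 8 *: T (T a) - 4 *: (2 *: T (T (T a))) by lmod.
by rewrite (tripotent_cubic JT uuu); lmod.
Qed.

Lemma Peirce0T a : P0 (T a) = 0.
Proof. rewrite /Peirce0 (tripotent_cubic JT uuu); lmod. Qed.

(** Since [T] is scalar on each Peirce space, this commutator formula expresses
    the blocks of [S] off the diagonal by triple products with the components of
    the single vector [S u]; the Peirce index selects the component. *)
Lemma tp_commutator x : S (T x) - T (S x) = tp (S u) u x - tp u (S u) x.
Proof. by rewrite jordan; lmod. Qed.

Lemma tp_Su_u x : tp (S u) u x = tp (P1 (S u)) u x + tp (P2 (S u)) u x.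
Proof.
rewrite -[in LHS](Peirce_sum tp u (S u)) 2!(tpDl JT).
by rewrite (tp_Peirce0_u JT uuu) ?add0r //; apply: eig_Peirce0.
Qed.

Lemma tp_u_Su x : tp u (S u) x = tp u (P1 (S u)) x + tp u (P2 (S u)) x.
Proof.
rewrite -[in LHS](Peirce_sum tp u (S u)) 2!(tpDm JT).
by rewrite (tp_u_Peirce0 JT uuu) ?add0r //; apply: eig_Peirce0.
Qed.

Lemma eig_tp_Peirce1_u k x : eig k x -> eig (k - 1) (tp (P1 (S u)) u x).
Proof.
move=> h; apply: (eig_tp JT (eig_Peirce1 JT uuu _) (eig_u uuu) h); rewrite ?conjC_nat //.
by ring.
Qed.

Lemma eig_tp_Peirce2_u k x : eig k x -> eig k (tp (P2 (S u)) u x).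
Proof.
move=> h; apply: (eig_tp JT (eig_Peirce2 JT uuu _) (eig_u uuu) h); rewrite ?conjC_nat //.
by ring.
Qed.

Lemma eig_tp_u_Peirce1 k x : eig k x -> eig (k + 1) (tp u (P1 (S u)) x).
Proof.
move=> h; apply: (eig_tp JT (eig_u uuu) (eig_Peirce1 JT uuu _) h); rewrite ?conjC1 //.
by ring.
Qed.

Lemma eig_tp_u_Peirce2 k x : eig k x -> eig k (tp u (P2 (S u)) x).
Proof.
move=> h; apply: (eig_tp JT (eig_u uuu) (eig_Peirce2 JT uuu _) h); rewrite ?conjC_nat //.
by ring.
Qed.

Lemma eig2_T x : eig 2 x -> T x = x.
Proof. by move=> h; apply: scaler2_inj. Qed.

Lemma eig0_T x : eig 0 x -> T x = 0.
Proof. by move=> h; apply: scaler2_inj; rewrite h scale0r scaler0. Qed.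

Lemma tp_u_Peirce1_eig2 x : eig 2 x -> tp u (P1 (S u)) x = 0.
Proof.
move=> h; apply: (eig_eq0 JT uuu (eig_tp_u_Peirce1 h)).
have -> : (2 + 1 : C) * (2 + 1 - 1) * (2 + 1 - 2) = 6%:R by ring.
by rewrite pnatr_eq0.
Qed.

Lemma tp_Peirce1_u_eig0 x : eig 0 x -> tp (P1 (S u)) u x = 0.
Proof.
move=> h; apply: (eig_eq0 JT uuu (eig_tp_Peirce1_u h)).
have -> : (0 - 1 : C) * (0 - 1 - 1) * (0 - 1 - 2) = - 6%:R by ring.
by rewrite oppr_eq0 pnatr_eq0.
Qed.

Lemma block02 x : eig 2 x -> P0 (S x) = 0.
Proof.
move=> h; have c := tp_commutator x; rewrite tp_Su_u tp_u_Su tp_u_Peirce1_eig2 // add0r in c.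
rewrite eig2_T // in c.
have -> : S x = (S x - T (S x)) + T (S x) by lmod.
rewrite Peirce0D Peirce0T addr0 c Peirce0D Peirce0N Peirce0D.
rewrite (Peirce0_eq0 JT (eig_tp_Peirce1_u h))
  ?(Peirce0_eq0 JT (eig_tp_Peirce2_u h))
  ?(Peirce0_eq0 JT (eig_tp_u_Peirce2 h)); try ring.
by rewrite !(oppr0, addr0).
Qed.

Lemma block20 x : eig 0 x -> P2 (S x) = 0.
Proof.
move=> h; have c := tp_commutator x; rewrite tp_Su_u tp_u_Su tp_Peirce1_u_eig0 // add0r in c.
rewrite (eig0_T h) (tp0r JT) sub0r in c.
rewrite -Peirce2T; apply: oppr_inj; rewrite oppr0 -Peirce2N c.
rewrite Peirce2D Peirce2N Peirce2D (Peirce2_eq0 JT (eig_tp_Peirce2_u h))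
  ?(Peirce2_eq0 JT (eig_tp_u_Peirce1 h))
  ?(Peirce2_eq0 JT (eig_tp_u_Peirce2 h)); try ring.
by rewrite !(oppr0, addr0).
Qed.

Lemma block21 x : eig 1 x -> P2 (S x) = 2 *: tp u (P1 (S u)) x.
Proof.
move=> h; have c := tp_commutator x; rewrite tp_Su_u tp_u_Su in c.
have c2 : 2 *: P2 (S (T x)) - 2 *: P2 (T (S x)) = - (2 *: tp u (P1 (S u)) x).
  have -> : 2 *: P2 (S (T x)) - 2 *: P2 (T (S x)) = 2 *: P2 (S (T x) - T (S x)).
    by rewrite Peirce2D Peirce2N; lmod.
  rewrite c Peirce2D Peirce2N !Peirce2D.
  rewrite (Peirce2_eq0 JT (eig_tp_Peirce1_u h))
  ?(Peirce2_eq0 JT (eig_tp_Peirce2_u h))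
  ?(Peirce2_eq0 JT (eig_tp_u_Peirce2 h)); try ring.
  by rewrite (Peirce2_id JT (eig_tp_u_Peirce1 h)); lmod.
have e : 2 *: P2 (S (T x)) = P2 (S x) by rewrite -Peirce2Z -(tpZr JT) h scale1r.
rewrite e Peirce2T in c2; apply: oppr_inj; rewrite -c2; lmod.
Qed.

Lemma block01 x : eig 1 x -> P0 (S x) = 2 *: tp (P1 (S u)) u x.
Proof.
move=> h; have c := tp_commutator x; rewrite tp_Su_u tp_u_Su in c.
have c2 : 2 *: P0 (S (T x)) - 2 *: P0 (T (S x)) = 2 *: tp (P1 (S u)) u x.
  have -> : 2 *: P0 (S (T x)) - 2 *: P0 (T (S x)) = 2 *: P0 (S (T x) - T (S x)).
    by rewrite Peirce0D Peirce0N; lmod.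
  rewrite c Peirce0D Peirce0N !Peirce0D.
  rewrite (Peirce0_eq0 JT (eig_tp_Peirce2_u h))
  ?(Peirce0_eq0 JT (eig_tp_u_Peirce1 h))
  ?(Peirce0_eq0 JT (eig_tp_u_Peirce2 h)); try ring.
  have e0 : eig 0 (tp (P1 (S u)) u x) by have := eig_tp_Peirce1_u h; rewrite subrr.
  by rewrite (Peirce0_id JT e0); lmod.
have e : 2 *: P0 (S (T x)) = P0 (S x) by rewrite -Peirce0Z -(tpZr JT) h scale1r.
by rewrite e Peirce0T scaler0 subr0 in c2.
Qed.

Lemma block10 x : eig 0 x -> P1 (S x) = 2 *: tp u (P1 (S u)) x.
Proof.
move=> h; have c := tp_commutator x; rewrite tp_Su_u tp_u_Su tp_Peirce1_u_eig0 // add0r in c.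
rewrite (eig0_T h) (tp0r JT) sub0r in c.
rewrite -Peirce1T; apply: oppr_inj; rewrite -scalerN -Peirce1N c.
rewrite Peirce1D Peirce1N Peirce1D (Peirce1_eq0 JT (eig_tp_Peirce2_u h))
  ?(Peirce1_eq0 JT (eig_tp_u_Peirce2 h)); try ring.
have e1 : eig 1 (tp u (P1 (S u)) x) by have := eig_tp_u_Peirce1 h; rewrite add0r.
by rewrite (Peirce1_id JT e1); lmod.
Qed.

End Blocks.

(** * A vector of the Peirce-1 space and the operator [L(y, y)] *)

Section PeirceOneVector.
Variables (C : numClosedFieldType) (E : lmodType C) (tp : E -> E -> E -> E).
Hypothesis JT : jordan_triple tp.
Local Notation sym := (tp_sym JT).
Local Notation jordan := (tp_jordan JT).
Variable y : E.
Local Notation L := (tp y y).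
Local Notation y3 := (tp y y y).

(** Two instances of the Jordan identity: one for [L(y,x)] applied to
    [{y,y,y}], the other for [L(y,y)] applied to [{y,x,y}]. *)
Lemma L_quadratic x : L (tp y x y) = tp y3 x y.
Proof.
have h1 : tp y x y3 = 2 *: L (tp y x y) - tp y (L x) y.
  by rewrite jordan (sym (tp y x y) y y) (sym x y y); lmod.
have h2 : L (tp y x y) = 2 *: tp y x y3 - tp y (L x) y.
  by rewrite jordan (sym y3 x y); lmod.
have h3 : 3 *: L (tp y x y) = 3 *: tp y x y3.
  have -> : 3 *: L (tp y x y) = L (tp y x y) + 2 *: L (tp y x y) by lmod.
  by rewrite {1}h2 {1 2}h1; lmod.
rewrite (sym y3 x y).
by apply: scalerI h3; rewrite pnatr_eq0.
Qed.

Lemma L_sqr x : 2 *: L (L x) = tp y (tp y x y) y + tp x y y3.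
Proof.
by rewrite (jordan x y y y y) (sym (tp x y y) y y) (sym x y y); lmod.
Qed.

Variable u : E.
Hypothesis uuu : tp u u u = u.
Hypothesis y1 : eig tp u 1 y.
Local Notation g := (tp u y y).
Local Notation w := (tp y u y).

Lemma tp_yuu : 2 *: tp y u u = y.
Proof. by rewrite sym y1 scale1r. Qed.

Lemma tp_u_y_w : 2 *: tp u y w = 4 *: tp g u y - y3.
Proof.
rewrite jordan (sym y u g).
have -> : 2 *: (tp g u y - tp y (tp y u u) y + tp g u y)
  = 4 *: tp g u y - tp y (2 *: tp y u u) y by rewrite (tpZm_nat JT); lmod.
by rewrite tp_yuu.
Qed.

(** The commutator [[L(u,y), L(y,u)]] is [L(g,u) - L(y,y) / 2], so that [L(y,y)]
    is determined by [L(u,y)], [L(y,u)] and the vector [g], which is small in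
    the application. *)
Lemma L_commutator x :
  L x = 2 *: tp g u x + 2 *: tp y u (tp u y x) - 2 *: tp u y (tp y u x).
Proof.
rewrite (jordan u y y u x).
have -> : 2 *: (tp g u x - tp y (tp y u u) x + tp y u (tp u y x))
  = 2 *: tp g u x - tp y (2 *: tp y u u) x + 2 *: tp y u (tp u y x).
  by rewrite (tpZm_nat JT); lmod.
by rewrite tp_yuu; lmod.
Qed.

Lemma tp_y_u_w : tp y u w = 0.
Proof.
have ew : eig tp u 0 w.
  by apply: (eig_tp JT y1 (eig_u uuu) y1); rewrite ?conjC_nat //; ring.
have nz : (1 - 2 + 0 : C) * (1 - 2 + 0 - 1) * (1 - 2 + 0 - 2) != 0.
  have -> : (1 - 2 + 0 : C) * (1 - 2 + 0 - 1) * (1 - 2 + 0 - 2) = - 6%:R by ring.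
  by rewrite oppr_eq0 pnatr_eq0.
by apply: (eig_tp_nil JT uuu y1 (eig_u uuu) ew); rewrite ?conjC_nat.
Qed.

(** Both sides come from [L w], computed once by the derivation property of [L]
    and once by the commutator formula. The term [{y,u,y3}] occurs with
    coefficients [2] and [-1], and is therefore expressed by [g]. *)
Lemma tp_y_u_cube :
  3 *: tp y u y3 = tp y g y + 2 *: tp g u w + 4 *: tp y u (tp g u y).
Proof.
have h1 : L w = 2 *: tp y u y3 - tp y g y.
  by rewrite jordan (sym y3 u y) (sym y y u); lmod.
have h2 : L w = 2 *: tp g u w + 4 *: tp y u (tp g u y) - tp y u y3.
  rewrite L_commutator tp_y_u_w (tp0r JT) -[2 *: tp y u _](tpZr JT) tp_u_y_w.
  by rewrite (tpBr JT) (tpZr JT); lmod.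
have -> : 3 *: tp y u y3 = (2 *: tp y u y3 - tp y g y) + tp y g y + tp y u y3 by lmod.
by rewrite -h1 h2; lmod.
Qed.

End PeirceOneVector.

(** * Norm estimates in a triple *)

(** The metric axioms of a JB*-triple in the form of estimates: the norm of
    [L(a,a)] is split into two inequalities, and [expi] replaces hermitian
    operators. *)
Record analytic_triple {R : realType} {C : numClosedFieldType} {RC : complexOver R C}
    {E : completeNormedModType C} (tp : E -> E -> E -> E) : Prop := AnalyticTriple {
  at_jordan : jordan_triple tp;
  at_bound : forall a x, nrm (tp a a x) <= nrm a ^+ 2 * nrm x;
  at_sharp : forall a c, (forall x, nrm x <= 1 -> nrm (tp a a x) <= c) -> nrm a ^+ 2 <= c;
  at_expi : forall a t x, nrm (expi t (tp a a) x) = nrm x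
}.

Section TripleNorm.
Context {R : realType} {C : numClosedFieldType} {RC : complexOver R C}.
Context {E : completeNormedModType C}.
Variable tp : E -> E -> E -> E.
Hypothesis AT : analytic_triple tp.
Local Notation JT := (at_jordan AT).

Lemma linear_op_tp a b : linear_op (tp a b).
Proof. by split=> *; rewrite ?(tpDr JT) ?(tpZr JT). Qed.

Lemma polarization a b x :
  4 *: tp a b x = tp (a + b) (a + b) x - tp (a - b) (a - b) x
    + 'i *: tp (a + 'i *: b) (a + 'i *: b) x - 'i *: tp (a - 'i *: b) (a - 'i *: b) x.
Proof.
have i2 := @sqrCi C; have ci := @conjCi C.
rewrite -!scaleNr -[- b]scaleN1r !(tpDl JT) !(tpDm JT) !(tpZl JT) !(tpZm JT).
rewrite !rmorphN /= ci conjC1; move: i2; move: 'i => J i2.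
lmod_coefficients; ring: i2.
Qed.

Lemma nrm_tp_sum a b x : nrm (tp a b x) <= (nrm a + nrm b) ^+ 2 * nrm x.
Proof.
have bd (z : C) : cabs z = 1 -> nrm (tp (a + z *: b) (a + z *: b) x) <= (nrm a + nrm b) ^+ 2 * nrm x.
  move=> z1; apply: le_trans (at_bound AT _ _) _; rewrite ler_wpM2r ?nrm_ge0 //.
  rewrite lerXn2r ?nnegrE ?nrm_ge0 ?addr_ge0 ?nrm_ge0 //.
  by apply: le_trans (nrmD _ _) _; rewrite nrmZ z1 mul1r.
apply: (nrm_le_scale (n := 4%N)) => //.
rewrite polarization.
have b1 := bd 1 cabs1; have b2 := bd (-1); have b3 := bd 'i cabs_i; have b4 := bd (- 'i).
rewrite cabsN cabs1 in b2; rewrite cabsN cabs_i in b4.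
rewrite scale1r in b1; rewrite scaleN1r in b2; rewrite scaleNr in b4.
apply: le_trans (nrmB _ _) _; rewrite nrmZ cabs_i mul1r.
apply: le_trans (lerD (nrmD _ _) (lexx _)) _; rewrite nrmZ cabs_i mul1r.
apply: le_trans (lerD (lerD (nrmB _ _) (lexx _)) (lexx _)) _.
by have := b2 erefl; have := b4 erefl; lra.
Qed.

(** The bound of [nrm_tp_sum] for unit vectors, scaled. *)
Lemma nrm_tp a b x : nrm (tp a b x) <= 4 * nrm a * nrm b * nrm x.
Proof.
have [->|a0] := eqVneq a 0; first by rewrite (tp0l JT) nrm0 !(mulr0, mul0r).
have [->|b0] := eqVneq b 0; first by rewrite (tp0m JT) nrm0 !(mulr0, mul0r).
have pos (c : E) : c != 0 -> 0 < nrm c.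
  by move=> c0; rewrite lt_neqAle nrm_ge0 andbT eq_sym; apply: contraNneq c0 => /nrm0_eq0 ->.
have na := pos a a0; have nb := pos b b0.
have unit (c : E) : 0 < nrm c -> c = rc (nrm c) *: (rc (nrm c)^-1 *: c) /\ nrm (rc (nrm c)^-1 *: c) = 1.
  move=> nc; split; first by rewrite scalerA -rmorphM divff ?gt_eqF // rmorph1 scale1r.
  by rewrite nrmZ cabs_rc gtr0_norm ?invr_gt0 // mulVf // gt_eqF.
have [aE a1] := unit a na; have [bE b1] := unit b nb.
rewrite {1}aE {1}bE (tpZl JT) (tpZm JT) conj_rc !nrmZ !cabs_rc !gtr0_norm //.
have h4 : nrm (tp (rc (nrm a)^-1 *: a) (rc (nrm b)^-1 *: b) x) <= 4 * nrm x.
  by apply: le_trans (nrm_tp_sum _ _ _) _; rewrite a1 b1; lra.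
have -> : 4 * nrm a * nrm b * nrm x = nrm a * (nrm b * (4 * nrm x)) by ring.
by rewrite !ler_pM2l.
Qed.

Lemma nrm_tp_le a b x ca cb cx : nrm a <= ca -> nrm b <= cb -> nrm x <= cx ->
  nrm (tp a b x) <= 4 * ca * cb * cx.
Proof.
move=> ha hb hx; apply: le_trans (nrm_tp _ _ _) _.
by rewrite !ler_pM ?mulr_ge0 ?nrm_ge0.
Qed.

Section Rotations.
Variable v : E.
Hypothesis vvv : tp v v v = v.
Local Notation S := (tp v v).
Local Notation R0 := (Peirce0 tp v).
Local Notation R1 := (Peirce1 tp v).
Local Notation R2 := (Peirce2 tp v).

Definition rotation (z : C) (x : E) : E := R0 x + z *: R1 x + z ^+ 2 *: R2 x.

Lemma rotationE s x : rotation (1 - s) x = x - (2 * s) *: S x + s ^+ 2 *: R2 x.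
Proof. by rewrite /rotation /Peirce0 /Peirce1 /Peirce2; lmod. Qed.

Lemma rotation1 x : rotation 1 x = x.
Proof. by rewrite -[RHS](Peirce_sum tp v x) /rotation expr1n !scale1r. Qed.

Lemma rotationM z z' x : rotation z (rotation z' x) = rotation (z * z') x.
Proof.
have e0 := eig_Peirce0 JT vvv x; have e1 := eig_Peirce1 JT vvv x; have e2 := eig_Peirce2 JT vvv x.
have h0 : R0 (rotation z' x) = R0 x.
  rewrite /rotation; move: (R0 x) e0 (R1 x) e1 (R2 x) e2 => a0 e0 a1 e1 a2 e2.
  rewrite 2!(Peirce0D JT) !(Peirce0Z JT) (Peirce0_id JT e0).
  by rewrite (Peirce0_eq0 JT e1) ?(Peirce0_eq0 JT e2); try ring; rewrite !scaler0 !addr0.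
have h1 : R1 (rotation z' x) = z' *: R1 x.
  rewrite /rotation; move: (R0 x) e0 (R1 x) e1 (R2 x) e2 => a0 e0 a1 e1 a2 e2.
  rewrite 2!(Peirce1D JT) !(Peirce1Z JT) (Peirce1_id JT e1).
  by rewrite (Peirce1_eq0 JT e0) ?(Peirce1_eq0 JT e2); try ring; rewrite !scaler0 addr0 add0r.
have h2 : R2 (rotation z' x) = z' ^+ 2 *: R2 x.
  rewrite /rotation; move: (R0 x) e0 (R1 x) e1 (R2 x) e2 => a0 e0 a1 e1 a2 e2.
  rewrite 2!(Peirce2D JT) !(Peirce2Z JT) (Peirce2_id JT e2).
  by rewrite (Peirce2_eq0 JT e0) ?(Peirce2_eq0 JT e1); try ring; rewrite !scaler0 addr0 add0r.
by rewrite {1}/rotation h0 h1 h2 /rotation exprMn !scalerA.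
Qed.

(** For [z = cis t] this is [exp (2 i t L(v, v))]. *)
Lemma rotation_isometry z x : cabs z = 1 -> nrm (rotation z x) = nrm x.
Proof.
move=> /unit_cis[t ->]; have [SD SZ] := linear_op_tp v v.
have e0 : S (R0 x) = rc 0 *: R0 x.
  by rewrite rmorph0; apply: scaler2_inj; rewrite (eig_Peirce0 JT vvv x) !scale0r scaler0.
have e1 : S (R1 x) = rc 2^-1 *: R1 x.
  have half : 2 * rc 2^-1 = 1 :> C.
    by rewrite -(rmorph_nat rc 2) -rmorphM mulfV ?pnatr_eq0 // rmorph1.
  by apply: scaler2_inj; rewrite (eig_Peirce1 JT vvv x) [RHS]scalerA half.
have e2 : S (R2 x) = rc 1 *: R2 x.
  by rewrite rmorph1; apply: scaler2_inj; rewrite (eig_Peirce2 JT vvv x) scale1r.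
have := expi_eigen (t + t) SD SZ e0 e1 e2; rewrite Peirce_sum mulr0 mulr1.
have -> : (t + t) * 2^-1 = t by field.
rewrite cis_double; have -> : cis 0 = 1 :> C by rewrite /cis cos0 sin0 rmorph1 rmorph0 mulr0 addr0.
by rewrite scale1r -/(rotation (cis t) x) => <-; exact: at_expi AT v (t + t) x.
Qed.

Lemma nrm_rotation_i x :
  [/\ nrm (rotation 'i x) = nrm x, nrm (rotation (- 'i) x) = nrm x
    & nrm (rotation (- 1) x) = nrm x].
Proof. by split; apply: rotation_isometry; rewrite ?cabsN ?cabs_i ?cabs1. Qed.

(** For real [r] the operator is a convex combination of its values at the
    fourth roots of unity, which are isometries. *)
Lemma rotation_real_contraction r x : 0 <= r <= 1 -> nrm (rotation (rc r) x) <= nrm x.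
Proof.
move=> /andP[r0 r1]; have [ni nNi nN1] := nrm_rotation_i x.
have i2 := @sqrCi C.
have E1 : 4 *: rotation (rc r) x = rc ((1 + r) ^+ 2) *: x
    + rc (1 - r ^+ 2) *: (rotation 'i x + rotation (- 'i) x)
    + rc ((1 - r) ^+ 2) *: rotation (- 1) x.
  rewrite -{2}(rotation1 x) /rotation !(rmorphXn, rmorphB, rmorphD, rmorph1) /=.
  move: i2; move: 'i (rc r) => J a i2.
  lmod_coefficients; ring: i2.
have p1 : 0 <= 1 - r ^+ 2 by rewrite subr_ge0 expr_le1.
apply: (nrm_le_scale (n := 4%N)) => //.
rewrite E1; apply: le_trans (nrmD _ _) _; apply: le_trans (lerD (nrmD _ _) (lexx _)) _.
rewrite !nrmZ !cabs_rc !ger0_norm ?sqr_ge0 // nN1.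
have : nrm (rotation 'i x + rotation (- 'i) x) <= 2 * nrm x.
  by apply: le_trans (nrmD _ _) _; rewrite ni nNi; lra.
move/(ler_wpM2l p1) => h; apply: le_trans (lerD (lerD (lexx _) h) (lexx _)) _.
by apply: ler_eq; ring.
Qed.

Lemma rotation_contraction z x : cabs z <= 1 -> nrm (rotation z x) <= nrm x.
Proof.
move=> z1; have [zE|z0] := eqVneq (cabs z) 0.
  have -> : z = rc 0 by rewrite rmorph0; apply/eqP; rewrite -normr_eq0 cabsE zE rmorph0.
  by apply: rotation_real_contraction; rewrite lexx ler01.
have zp : 0 < cabs z by rewrite lt_neqAle cabs_ge0 eq_sym z0.
have -> : z = rc (cabs z) * (rc (cabs z)^-1 * z).
  by rewrite mulrA -rmorphM divff // rmorph1 mul1r.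
rewrite -rotationM; apply: le_trans (rotation_real_contraction _ _) _.
  by rewrite cabs_ge0.
by rewrite rotation_isometry // cabsM cabs_rc gtr0_norm ?invr_gt0 // mulVf.
Qed.

Lemma nrm_Peirce2 x : nrm (R2 x) <= nrm x.
Proof.
have [ni nNi nN1] := nrm_rotation_i x; have i2 := @sqrCi C.
have E1 : 4 *: R2 x = x - rotation 'i x + rotation (- 1) x - rotation (- 'i) x.
  rewrite -{2}(rotation1 x) /rotation; move: i2; move: 'i => J i2.
  lmod_coefficients; ring: i2.
apply: (nrm_le_scale (n := 4%N)) => //.
rewrite E1; apply: le_trans (nrmB _ _) _; apply: le_trans (lerD (nrmD _ _) (lexx _)) _.
apply: le_trans (lerD (lerD (nrmB _ _) (lexx _)) (lexx _)) _.
by rewrite ni nNi nN1; lra.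
Qed.

Lemma nrm_Peirce1 x : nrm (R1 x) <= nrm x.
Proof.
have [ni nNi nN1] := nrm_rotation_i x; have i2 := @sqrCi C.
have E1 : 4 *: R1 x = x - 'i *: rotation 'i x - rotation (- 1) x + 'i *: rotation (- 'i) x.
  rewrite -{2}(rotation1 x) /rotation; move: i2; move: 'i => J i2.
  lmod_coefficients; ring: i2.
apply: (nrm_le_scale (n := 4%N)) => //.
rewrite E1; apply: le_trans (nrmD _ _) _; apply: le_trans (lerD (nrmB _ _) (lexx _)) _.
apply: le_trans (lerD (lerD (nrmB _ _) (lexx _)) (lexx _)) _.
by rewrite !nrmZ cabs_i ni nNi nN1; lra.
Qed.

Lemma nrm_tripotent_op x : nrm (S x) <= nrm x.
Proof.
have [ni nNi nN1] := nrm_rotation_i x; have i2 := @sqrCi C.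
have E1 : 4 *: S x = 2 *: x - rotation 'i x - rotation (- 'i) x.
  rewrite /rotation /Peirce0 /Peirce1 /Peirce2; move: i2; move: 'i => J i2.
  lmod_coefficients; ring: i2.
apply: (nrm_le_scale (n := 4%N)) => //.
rewrite E1; apply: le_trans (nrmB _ _) _.
apply: le_trans (lerD (nrmB _ _) (lexx _)) _.
by rewrite !nrmZ cabs_nat ni nNi; lra.
Qed.

(** The norm of [v] is the square root of that of [L(v,v)], a contraction. *)
Lemma nrm_tripotent : nrm v <= 1.
Proof.
rewrite -(ler_pXn2r (n := 2)) ?nnegrE ?nrm_ge0 // expr1n.
apply: at_sharp AT v 1 _ => x x1.
exact: le_trans (nrm_tripotent_op x) x1.
Qed.

End Rotations.
End TripleNorm.

(** * Two tripotents *)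

Section TwoTripotents.
Context {R : realType} {C : numClosedFieldType} {RC : complexOver R C}.
Context {E : completeNormedModType C}.
Variable tp : E -> E -> E -> E.
Hypothesis AT : analytic_triple tp.
Local Notation JT := (at_jordan AT).
Variables u v : E.
Hypothesis uuu : tp u u u = u.
Hypothesis vvv : tp v v v = v.
Local Notation S := (tp v v).
Local Notation R2 := (Peirce2 tp v).
Local Notation P0 := (Peirce0 tp u).
Local Notation P1 := (Peirce1 tp u).
Local Notation P2 := (Peirce2 tp u).
Local Notation F := (eig tp u 2).

Lemma stable_compression (B : E -> E) :
  stable_subspace F (fun x => P2 (B x)).
Proof.
split=> [x y|a x|x _]; last exact: (eig_Peirce2 JT uuu).
  by rewrite /eig (tpDr JT) !scalerDr => -> ->.
rewrite /eig (tpZr JT) => h.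
have -> : 2 *: (a *: tp u u x) = a *: (2 *: tp u u x) by lmod.
by rewrite h; lmod.
Qed.

Lemma linear_compression (B : E -> E) :
  linear_op B -> linear_op (fun x => P2 (B x)).
Proof.
case=> BD BZ; split=> [x y|a x]; first by rewrite BD (Peirce2D JT).
by rewrite BZ (Peirce2Z JT).
Qed.

Lemma linear_Peirce2 w : linear_op (Peirce2 tp w).
Proof. by split=> *; rewrite ?(Peirce2D JT) ?(Peirce2Z JT). Qed.

Lemma linear_Peirce1 w : linear_op (Peirce1 tp w).
Proof. by split=> *; rewrite ?(Peirce1D JT) ?(Peirce1Z JT). Qed.

Lemma linear_comp (A B : E -> E) : linear_op A -> linear_op B -> linear_op (fun x => A (B x)).
Proof. by case=> AD AZ [BD BZ]; split=> *; rewrite ?BD ?BZ ?AD ?AZ. Qed.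

Lemma linear_scale (a : C) (A : E -> E) : linear_op A -> linear_op (fun x => a *: A x).
Proof. by case=> AD AZ; split=> *; rewrite ?AD ?AZ; lmod. Qed.

Lemma compressed_rotation s x : F x ->
  P2 (rotation tp v (1 - s) x) = x - (2 * s) *: P2 (S x) + s ^+ 2 *: P2 (R2 x).
Proof.
move=> Fx; rewrite rotationE.
move: (S x) (R2 x) => a b.
rewrite 2!(Peirce2D JT) (Peirce2N JT) (Peirce2Z JT _ (2 * s)) (Peirce2Z JT _ (s ^+ 2)).
by rewrite (Peirce2_id JT Fx).
Qed.

Lemma nrm_compressed_rotation s x : cabs (1 - s) <= 1 -> F x ->
  nrm (x - (2 * s) *: P2 (S x) + s ^+ 2 *: P2 (R2 x)) <= nrm x.
Proof.
move=> s1 Fx; rewrite -compressed_rotation //.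
by apply: le_trans (nrm_Peirce2 AT uuu _) _; exact: (rotation_contraction AT vvv).
Qed.

Lemma nrm_P2_S x : nrm (P2 (S x)) <= nrm x.
Proof.
by apply: le_trans (nrm_Peirce2 AT uuu _) _; exact: (nrm_tripotent_op AT vvv).
Qed.

Lemma nrm_P2_R2 x : nrm (P2 (R2 x)) <= nrm x.
Proof.
by apply: le_trans (nrm_Peirce2 AT uuu _) _; exact: (nrm_Peirce2 AT vvv).
Qed.

(** [2 (L(u,u) + L(v,v))] is [L(u+v,u+v) + L(u-v,u-v)], and [L(u,u)] is the
    identity on the Peirce-2 space of [u]. *)
Lemma nrm_id_plus_P2_S d x : 0 <= d <= 1 -> nrm (u + v) <= 1 + d -> nrm (u - v) <= 1 + d -> F x ->
  nrm (x + P2 (S x)) <= (1 + 3 * d) * nrm x.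
Proof.
move=> /andP[d0 d1] hp hm Fx.
have -> : x + P2 (S x) = P2 (x + S x) by rewrite (Peirce2D JT) (Peirce2_id JT Fx).
apply: le_trans (nrm_Peirce2 AT uuu _) _.
have E1 : 2 *: (x + S x) = tp (u + v) (u + v) x + tp (u - v) (u - v) x.
  rewrite scalerDr -Fx -[- v]scaleN1r !(tpDl JT) !(tpDm JT) !(tpZl JT) !(tpZm JT).
  by rewrite rmorphN1; lmod.
have sq a : nrm a <= 1 + d -> nrm (tp a a x) <= (1 + 3 * d) * nrm x.
  move=> a1; apply: le_trans (at_bound AT _ _) _; rewrite ler_wpM2r ?nrm_ge0 //.
  apply: (@le_trans _ _ ((1 + d) ^+ 2)); first by rewrite lerXn2r ?nnegrE ?nrm_ge0 ?addr_ge0.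
  have : d ^+ 2 <= d by rewrite expr2 ler_piMl.
  lra.
apply: (nrm_le_scale (n := 2%N)) => //.
by rewrite E1; apply: le_trans (nrmD _ _) _; have := sq _ hp; have := sq _ hm; lra.
Qed.

Lemma S_split x : F x -> S x = P1 (S x) + P2 (S x).
Proof.
move=> Fx; rewrite -[LHS](Peirce_sum tp u).
by rewrite (block02 JT v uuu Fx) add0r.
Qed.

Lemma S_sqr x : 2 *: S (S x) = R2 x + S x.
Proof. by rewrite /Peirce2; lmod. Qed.

Lemma S_R2 x : S (R2 x) = R2 x.
Proof. by apply: scaler2_inj; exact: (eig_Peirce2 JT vvv). Qed.

Lemma P2_S_split x : P2 (S x) = P2 (S (P1 x)) + P2 (S (P2 x)).
Proof.
rewrite -[in LHS](Peirce_sum tp u x).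
have e0 := eig_Peirce0 JT uuu x.
move: (Peirce0 tp u x) e0 (Peirce1 tp u x) (Peirce2 tp u x) => a e0 b c.
rewrite 2!(tpDr JT) 2!(Peirce2D JT).
by rewrite (block20 JT v uuu e0) add0r.
Qed.

(** Here and below a product of two operators commuting with [S] is expanded
    along the Peirce spaces of [u]; the paths through the Peirce-0 space vanish
    by [block02] and [block20]. *)
Lemma block_SS x : F x ->
  2 *: P2 (S (P1 (S x))) = P2 (R2 x) + P2 (S x) - 2 *: P2 (S (P2 (S x))).
Proof.
move=> Fx; have h := P2_S_split (S x).
have -> : P2 (R2 x) + P2 (S x) = 2 *: P2 (S (S x)).
  by rewrite -(Peirce2D JT) -S_sqr (Peirce2Z JT).
by rewrite h; lmod.
Qed.

Lemma block_SR x : F x -> P2 (S (P1 (R2 x))) = P2 (R2 x) - P2 (S (P2 (R2 x))).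
Proof.
move=> Fx; have := P2_S_split (R2 x); rewrite S_R2 => h.
by apply/eqP; rewrite eq_sym subr_eq; apply/eqP.
Qed.

Lemma block_RS x : F x -> P2 (R2 (P1 (S x))) = P2 (R2 x) - P2 (R2 (P2 (S x))).
Proof.
move=> Fx; have h : R2 x = R2 (P1 (S x)) + R2 (P2 (S x)).
  by rewrite -(linear_Peirce2 v).1 -S_split // (Peirce2T JT vvv).
by rewrite h (Peirce2D JT) addrK.
Qed.

Section Bounds.
Variable d : R.
Hypothesis d01 : 0 <= d <= 1.
Hypothesis hK : forall x, F x -> nrm (P2 (S x)) <= d * nrm x.
Hypothesis hA : forall x, F x -> nrm (P2 (R2 x)) <= d * nrm x.

Lemma nrm_block_SS x : F x -> nrm (P2 (S (P1 (S x)))) <= 2 * d * nrm x.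
Proof.
move=> Fx; apply: (nrm_le_scale (n := 2%N)) => //.
rewrite block_SS //; apply: le_trans (nrmB _ _) _.
apply: le_trans (lerD (nrmD _ _) (lexx _)) _; rewrite [X in _ + X]nrmZ cabs_nat.
have := hK Fx; have := hA Fx.
have := hK (eig_Peirce2 JT uuu (S x)).
have := nrm_P2_S x.
move: (nrm (P2 (S (P2 (S x))))) (nrm (P2 (S x))) (nrm (P2 (R2 x))) => a b c.
move=> bx ab cx bdx.
have : d * b <= d * nrm x by rewrite ler_wpM2l //; case/andP: d01.
by lra.
Qed.

Lemma nrm_block_SR x : F x -> nrm (P2 (S (P1 (R2 x)))) <= 2 * d * nrm x.
Proof.
move=> Fx; rewrite block_SR //; apply: le_trans (nrmB _ _) _.
have := hA Fx; have := hK (eig_Peirce2 JT uuu (R2 x)); have := nrm_P2_R2 x.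
move: (nrm (P2 (S (P2 (R2 x))))) (nrm (P2 (R2 x))) => a b bx ab bdx.
have : d * b <= d * nrm x by rewrite ler_wpM2l //; case/andP: d01.
by lra.
Qed.

Lemma nrm_block_RS x : F x -> nrm (P2 (R2 (P1 (S x)))) <= 2 * d * nrm x.
Proof.
move=> Fx; rewrite block_RS //; apply: le_trans (nrmB _ _) _.
have := hA Fx; have := hA (eig_Peirce2 JT uuu (S x)); have := nrm_P2_S x.
move: (nrm (P2 (R2 (P2 (S x))))) (nrm (P2 (S x))) => a b bx ab bdx.
have : d * b <= d * nrm x by rewrite ler_wpM2l //; case/andP: d01.
by lra.
Qed.

Lemma cabs_disc s : cabs (1 - s) <= 1 -> cabs s <= 2 :> R.
Proof.
move=> h; have -> : s = 1 - (1 - s) by ring.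
by apply: le_trans (cabsD _ _) _; rewrite cabsN cabs1; lra.
Qed.

(** The symmetry [id - 2 P1] of the triple changes the sign of the paths through
    the Peirce-1 space. Compared with the compression of [W (W x)], which is a
    rotation again, this singles out the paths from [2] to [1] to [2]. *)
Lemma double_rotation s x : F x ->
  let s' := 2 * s - s ^+ 2 in let W := rotation tp v (1 - s) in
  P2 (W (W x - 2 *: P1 (W x)))
  = (x - (2 * s ^+ 4) *: P2 (R2 (P1 (R2 x)))) - (2 * s') *: P2 (S x) + s' ^+ 2 *: P2 (R2 x)
    - (8 * s ^+ 2) *: P2 (S (P1 (S x)))
    + (4 * s ^+ 3) *: (P2 (S (P1 (R2 x))) + P2 (R2 (P1 (S x)))).
Proof.
move=> Fx s' W.
have WD a b : W (a + b) = W a + W b.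
  rewrite /W !rotationE (tpDr JT) (linear_Peirce2 v).1; lmod.
have WZ k a : W (k *: a) = k *: W a.
  rewrite /W !rotationE (tpZr JT) (linear_Peirce2 v).2; lmod.
have WW : W (W x) = rotation tp v (1 - s') x.
  by rewrite /W (rotationM AT vvv); congr rotation; rewrite /s'; ring.
rewrite -scaleNr WD WZ WW (Peirce2D JT) (Peirce2Z JT) compressed_rotation //.
have P1x : P1 x = 0 by apply: (Peirce1_eq0 JT Fx); ring.
have P1W : P1 (W x) = - (2 * s) *: P1 (S x) + s ^+ 2 *: P1 (R2 x).
  rewrite /W rotationE.
  move: (S x) (R2 x) => a b.
  rewrite 2!(Peirce1D JT) (Peirce1N JT) (Peirce1Z JT _ (2 * s)) (Peirce1Z JT _ (s ^+ 2)) P1x.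
  by lmod.
have P2W a : eig tp u 1 a -> P2 (W a) = - (2 * s) *: P2 (S a) + s ^+ 2 *: P2 (R2 a).
  move=> ha; have P2a : P2 a = 0 by apply: (Peirce2_eq0 JT ha); ring.
  rewrite /W rotationE; move: (S a) (R2 a) => b c.
  rewrite 2!(Peirce2D JT) (Peirce2N JT) (Peirce2Z JT _ (2 * s)) (Peirce2Z JT _ (s ^+ 2)) P2a.
  by lmod.
have P2WP1 : P2 (W (P1 (W x)))
    = - (2 * s) *: (- (2 * s) *: P2 (S (P1 (S x))) + s ^+ 2 *: P2 (R2 (P1 (S x))))
      + s ^+ 2 *: (- (2 * s) *: P2 (S (P1 (R2 x))) + s ^+ 2 *: P2 (R2 (P1 (R2 x)))).
  rewrite -!P2W; [|exact: (eig_Peirce1 JT uuu)..].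
  rewrite P1W WD !WZ; move: (W _) (W _) => a b.
  by rewrite (Peirce2D JT) (Peirce2Z JT _ (- _)) (Peirce2Z JT _ (s ^+ 2)).
by rewrite P2WP1 /s'; lmod.
Qed.

(** The coefficients of the small terms are at most [16], [64], [32 * 2] and
   [32 * 4], whose sum is less than [300]. *)
Lemma nrm_double_rotation s x : cabs (1 - s) <= 1 -> F x ->
  nrm (x + s ^+ 4 *: (- 2%:R *: P2 (R2 (P1 (R2 x))))) <= (1 + 300 * d) * nrm x.
Proof.
move=> s1 Fx; have s2 := cabs_disc s1.
have s0 : 0 <= cabs s by exact: cabs_ge0.
pose s' := 2 * s - s ^+ 2.
have h := double_rotation s Fx; cbv zeta in h; rewrite -/s' in h.
set z := x + _.
set l := P2 (rotation _ _ _ _) in h.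
have zE : z = l + (2 * s') *: P2 (S x) - s' ^+ 2 *: P2 (R2 x)
    + (8 * s ^+ 2) *: P2 (S (P1 (S x)))
    - (4 * s ^+ 3) *: (P2 (S (P1 (R2 x))) + P2 (R2 (P1 (S x)))).
  by rewrite h /z; lmod.
have nl : nrm l <= nrm x.
  apply: le_trans (nrm_Peirce2 AT uuu _) _.
  apply: le_trans (rotation_contraction AT vvv _ s1) _.
  set W := rotation _ _ _ x.
  have -> : W - 2 *: P1 W = rotation tp u (-1) W.
    rewrite -{1}(Peirce_sum tp u W) /rotation; lmod.
  rewrite (rotation_isometry AT uuu) ?cabsN ?cabs1 //.
  exact: (rotation_contraction AT vvv).
have c2 : cabs (s ^+ 2) <= 4.
  by rewrite cabsX (_ : 4 = 2 ^+ 2) ?lerXn2r ?nnegrE //; ring.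
have c3 : cabs (s ^+ 3) <= 8.
  by rewrite cabsX (_ : 8 = 2 ^+ 3) ?lerXn2r ?nnegrE //; ring.
have c' : cabs s' <= 8.
  by apply: le_trans (cabsD _ _) _; rewrite cabsN cabsM cabs_nat; lra.
have c'2 : cabs (s' ^+ 2) <= 64.
  by rewrite cabsX (_ : 64 = 8 ^+ 2) ?lerXn2r ?nnegrE ?cabs_ge0 //; ring.
have scaled (k : C) (a : E) c e : cabs k <= c -> nrm a <= e -> nrm (k *: a) <= c * e.
  by move=> kc ae; rewrite nrmZ ler_pM ?cabs_ge0 ?nrm_ge0.
have t1 : nrm ((2 * s') *: P2 (S x)) <= 16 * (d * nrm x).
  by apply: scaled; rewrite ?hK // cabsM cabs_nat; lra.
have t2 : nrm (s' ^+ 2 *: P2 (R2 x)) <= 64 * (d * nrm x) by apply: scaled; rewrite ?hA.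
have t3 : nrm ((8 * s ^+ 2) *: P2 (S (P1 (S x)))) <= 32 * (2 * d * nrm x).
  by apply: scaled; rewrite ?nrm_block_SS // cabsM cabs_nat; lra.
have t4 : nrm ((4 * s ^+ 3) *: (P2 (S (P1 (R2 x))) + P2 (R2 (P1 (S x)))))
    <= 32 * (2 * d * nrm x + 2 * d * nrm x).
  apply: scaled; first by rewrite cabsM cabs_nat; lra.
  by apply: le_trans (nrmD _ _) _; apply: lerD; [exact: nrm_block_SR|exact: nrm_block_RS].
have dx : 0 <= d * nrm x by rewrite mulr_ge0 ?nrm_ge0 //; case/andP: d01.
rewrite zE; apply: le_trans (nrmB _ _) _; apply: le_trans (lerD (nrmD _ _) (lexx _)) _.
apply: le_trans (lerD (lerD (nrmB _ _) (lexx _)) (lexx _)) _.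
apply: le_trans (lerD (lerD (lerD (nrmD _ _) (lexx _)) (lexx _)) (lexx _)) _.
lra.
Qed.

End Bounds.
End TwoTripotents.

(** * The blocks of [L(v,v)] issuing from the Peirce-2 space of [u] are small *)

Lemma compressed_L_small {R : realType} (eps : R) : 0 < eps ->
  exists2 del : R, 0 < del & forall (C : numClosedFieldType) (RC : complexOver R C)
    (E : completeNormedModType C) (tp : E -> E -> E -> E) (u v : E),
    analytic_triple tp -> tp u u u = u -> tp v v v = v ->
    nrm (u + v) <= 1 + del -> nrm (u - v) <= 1 + del ->
    forall x, eig tp u 2 x -> nrm (Peirce2 tp u (tp v v x)) <= eps * nrm x.
Proof.
move=> e0; have [d d0 hd] := small_of_halfplane e0 (@ler01 R).
exists (Num.min 1 (d / 3)); first by rewrite lt_min ltr01 divr_gt0.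
move=> C RC E tp u v AT uuu vvv hp hm x Fx.
have m0 : 0 <= Num.min 1 (d / 3) by rewrite le_min ler01 divr_ge0 // ltW.
have m1 : Num.min 1 (d / 3) <= 1 by rewrite ge_min lexx.
have md : 3 * Num.min 1 (d / 3) <= d.
  have : Num.min 1 (d / 3) <= d / 3 by rewrite ge_min lexx orbT.
  by move: (Num.min _ _) => m; lra.
apply: (hd C RC E (eig tp u 2) (fun x => Peirce2 tp u (tp v v x))
  (fun x => Peirce2 tp u (Peirce2 tp v x)) (3 * Num.min 1 (d / 3))) => //.
- exact: linear_compression (linear_op_tp AT v v).
- exact: stable_compression.
- by rewrite md mulr_ge0.
- by move=> y _; rewrite mul1r; exact: nrm_P2_S.
- by move=> y _; rewrite mul1r; exact: nrm_P2_R2.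
- by move=> s y s1 Fy; exact: nrm_compressed_rotation.
- by move=> y Fy; apply: nrm_id_plus_P2_S; rewrite ?m0.
Qed.

(** The next coefficient of the compressed rotation, of order [s ^ 2]. *)
Lemma compressed_Peirce2_small {R : realType} (eps : R) : 0 < eps ->
  exists2 del : R, 0 < del & forall (C : numClosedFieldType) (RC : complexOver R C)
    (E : completeNormedModType C) (tp : E -> E -> E -> E) (u v : E),
    analytic_triple tp -> tp u u u = u -> tp v v v = v ->
    (forall x, eig tp u 2 x -> nrm (Peirce2 tp u (tp v v x)) <= del * nrm x) ->
    forall x, eig tp u 2 x -> nrm (Peirce2 tp u (Peirce2 tp v x)) <= eps * nrm x.
Proof.
move=> e0; have [d d0 hd] := @small_of_cusp R eps 1 2 (or_introl erefl) e0 ler01.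
exists (d / 4); first by rewrite divr_gt0.
move=> C RC E tp u v AT uuu vvv hK x Fx.
apply: (hd C RC E (eig tp u 2) (fun x => Peirce2 tp u (Peirce2 tp v x)) d) => //.
- exact: linear_compression (linear_Peirce2 AT v).
- exact: stable_compression.
- by rewrite lexx ltW.
- by move=> y _; rewrite mul1r; exact: nrm_P2_R2.
move=> s y s1 Fy; have s2 := cabs_disc s1.
have := nrm_compressed_rotation AT uuu vvv s1 Fy.
set z := y - _ + _ => hz.
have -> : y + s ^+ 2 *: Peirce2 tp u (Peirce2 tp v y)
    = z + (2 * s) *: Peirce2 tp u (tp v v y) by rewrite /z; lmod.
apply: le_trans (nrmD _ _) _; rewrite [leRHS]mulrDl mul1r; apply: lerD => //.
rewrite nrmZ cabsM cabs_nat.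
apply: (@le_trans _ _ (4 * (d / 4 * nrm y))).
  by rewrite ler_pM ?mulr_ge0 ?cabs_ge0 ?nrm_ge0 ?hK //; lra.
by apply: ler_eq; field.
Qed.

(** The coefficient of order [s ^ 4] of the contraction in [double_rotation]. *)
Lemma double_Peirce2_block_small {R : realType} (eps : R) : 0 < eps ->
  exists2 del : R, 0 < del & forall (C : numClosedFieldType) (RC : complexOver R C)
    (E : completeNormedModType C) (tp : E -> E -> E -> E) (u v : E),
    analytic_triple tp -> tp u u u = u -> tp v v v = v ->
    (forall x, eig tp u 2 x -> nrm (Peirce2 tp u (tp v v x)) <= del * nrm x) ->
    (forall x, eig tp u 2 x -> nrm (Peirce2 tp u (Peirce2 tp v x)) <= del * nrm x) ->
    forall x, eig tp u 2 x ->
      nrm (Peirce2 tp u (Peirce2 tp v (Peirce1 tp u (Peirce2 tp v x)))) <= eps * nrm x.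
Proof.
move=> e0; have e20 : 0 < 2 * eps by rewrite mulr_gt0.
have [d d0 hd] := @small_of_cusp R (2 * eps) 2 4 (or_intror erefl) e20 (ler0n R 2).
have d300 : 0 < d / 300 by apply: divr_gt0 d0 _; rewrite ltr0n.
exists (Num.min 1 (d / 300)); first by rewrite lt_min ltr01 d300.
move=> C RC E tp u v AT uuu vvv hK hA x Fx.
have m0 : 0 <= Num.min 1 (d / 300) by rewrite le_min ler01 (ltW d300).
have m1 : Num.min 1 (d / 300) <= 1 by rewrite ge_min lexx.
have md : 300 * Num.min 1 (d / 300) <= d.
  have : Num.min 1 (d / 300) <= d / 300 by rewrite ge_min lexx orbT.
  by move: (Num.min _ _) => m; lra.
pose B x := - 2%:R *: Peirce2 tp u (Peirce2 tp v (Peirce1 tp u (Peirce2 tp v x))).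
have : nrm (B x) <= (2 * eps) * nrm x.
  apply: (hd C RC E (eig tp u 2) B d) => //.
  - have lB : linear_op (fun y => Peirce2 tp v (Peirce1 tp u (Peirce2 tp v y))).
      apply: linear_comp; first exact: linear_Peirce2.
      by apply: linear_comp; [exact: linear_Peirce1|exact: linear_Peirce2].
    by apply: linear_scale; exact: linear_compression lB.
  - have [FD FZ FB] := stable_compression AT uuu (fun y => Peirce2 tp v (Peirce1 tp u (Peirce2 tp v y))).
    by split=> // y Fy; apply: FZ; exact: FB.
  - by rewrite lexx ltW.
  - move=> y Fy; rewrite /B nrmZ cabsN cabs_nat ler_pM2l //.
    apply: le_trans (nrm_P2_R2 AT uuu vvv _) _; apply: le_trans (nrm_Peirce1 AT uuu _) _.
    exact: nrm_Peirce2.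
  - move=> s y s1 Fy.
    apply: le_trans (nrm_double_rotation AT uuu vvv _ hK hA s1 Fy) _; first by rewrite m0.
    by rewrite ler_wpM2r ?nrm_ge0 ?lerD2l.
by rewrite /B nrmZ cabsN cabs_nat -mulrA ler_pM2l.
Qed.

Section Vectors.
Context {R : realType} {C : numClosedFieldType} {RC : complexOver R C}.
Context {E : completeNormedModType C}.
Variable tp : E -> E -> E -> E.
Hypothesis AT : analytic_triple tp.
Local Notation JT := (at_jordan AT).
Variables u v : E.
Hypothesis uuu : tp u u u = u.
Hypothesis vvv : tp v v v = v.
Local Notation S := (tp v v).
Local Notation R2 := (Peirce2 tp v).
Local Notation P0 := (Peirce0 tp u).
Local Notation P1 := (Peirce1 tp u).
Local Notation P2 := (Peirce2 tp u).
Local Notation F := (eig tp u 2).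
Local Notation y := (P1 (S u)).
Local Notation L := (tp y y).
Local Notation y3 := (tp y y y).

Variable d : R.
Hypothesis d01 : 0 <= d <= 1.
Hypothesis hK : forall x, F x -> nrm (P2 (S x)) <= d * nrm x.
Hypothesis hA : forall x, F x -> nrm (P2 (R2 x)) <= d * nrm x.
Hypothesis hZ : forall x, F x -> nrm (P2 (R2 (P1 (R2 x)))) <= d * nrm x.

Lemma nrm_u : nrm u <= 1.
Proof. exact: (nrm_tripotent AT uuu). Qed.

Lemma nrm_y : nrm y <= 1.
Proof.
apply: le_trans (nrm_Peirce1 AT uuu _) _.
by apply: le_trans (nrm_tripotent_op AT vvv _) _; exact: nrm_u.
Qed.

Lemma d_nrm_u : d * nrm u <= d.
Proof. by rewrite ler_piMr ?nrm_u //; case/andP: d01. Qed.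

Lemma eig_y : eig tp u 1 y.
Proof. exact: (eig_Peirce1 JT uuu). Qed.

Lemma Su_split : S u = y + P2 (S u).
Proof. exact: (S_split AT v uuu (eig_u uuu)). Qed.

Lemma nrm_P2_S_u : nrm (P2 (S u)) <= d.
Proof. by apply: le_trans (hK (eig_u uuu)) _; exact: d_nrm_u. Qed.

Lemma nrm_P2_S_P1_S z : nrm (P2 (S (P1 (S z)))) <= nrm z.
Proof.
apply: le_trans (nrm_P2_S AT uuu vvv _) _; apply: le_trans (nrm_Peirce1 AT uuu _) _.
exact: (nrm_tripotent_op AT vvv).
Qed.

Lemma nrm_g : nrm (tp u y y) <= d.
Proof.
have h : 2 *: tp u y y = P2 (S y) by rewrite (block21 JT v uuu eig_y).
apply: (nrm_le_scale (n := 2%N)) => //.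
rewrite h; apply: le_trans (nrm_block_SS AT uuu vvv d01 hK hA (eig_u uuu)) _.
by rewrite -mulrA ler_pM2l // d_nrm_u.
Qed.

(** The digits in the names of the next lemmas list the Peirce spaces of [u]
    visited by a product of blocks of [S], from the last to the first. *)
Lemma nrm_path2112 : nrm (P2 (S (P1 (S y)))) <= 3 * d.
Proof.
have e : 2 *: P2 (S (P1 (S y)))
    = P2 (S (P1 (R2 u))) + P2 (S (P1 (S u))) - 2 *: P2 (S (P1 (S (P2 (S u))))).
  have -> : P2 (S (P1 (R2 u))) + P2 (S (P1 (S u))) = 2 *: P2 (S (P1 (S (S u)))).
    rewrite -(Peirce2D JT) -(tpDr JT) -(Peirce1D JT) -S_sqr.
    by rewrite (Peirce1Z JT) (tpZr JT) (Peirce2Z JT).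
  rewrite [in X in _ = 2 *: P2 (S (P1 (S X))) - _]Su_split.
  by rewrite (tpDr JT) (Peirce1D JT) (tpDr JT) (Peirce2D JT); lmod.
apply: (nrm_le_scale (n := 2%N)) => //.
rewrite e; apply: le_trans (nrmB _ _) _; apply: le_trans (lerD (nrmD _ _) (lexx _)) _.
rewrite [X in _ + X]nrmZ cabs_nat.
have := nrm_block_SR AT uuu vvv d01 hK hA (eig_u uuu).
have := nrm_block_SS AT uuu vvv d01 hK hA (eig_u uuu).
have := nrm_P2_S_P1_S (P2 (S u)).
have := nrm_P2_S_u; have := d_nrm_u.
lra.
Qed.

Lemma nrm_R2_path112 : nrm (P2 (R2 (P1 (S y)))) <= 3 * d.
Proof.
have e : 2 *: P2 (R2 (P1 (S y)))
    = P2 (R2 (P1 (R2 u))) + P2 (R2 y) - 2 *: P2 (R2 (P1 (S (P2 (S u))))).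
  have -> : P2 (R2 (P1 (R2 u))) + P2 (R2 y) = 2 *: P2 (R2 (P1 (S (S u)))).
    rewrite -(Peirce2D JT) -(linear_Peirce2 AT v).1 -(Peirce1D JT) -S_sqr.
    by rewrite (Peirce1Z JT) (linear_Peirce2 AT v).2 (Peirce2Z JT).
  rewrite [in X in _ = 2 *: P2 (R2 (P1 (S X))) - _]Su_split.
  move: (P2 (S u)) => z.
  rewrite (tpDr JT) (Peirce1D JT) (linear_Peirce2 AT v).1.
  by rewrite [X in _ = 2 *: X - _](Peirce2D JT); lmod.
apply: (nrm_le_scale (n := 2%N)) => //.
rewrite e; apply: le_trans (nrmB _ _) _; apply: le_trans (lerD (nrmD _ _) (lexx _)) _.
rewrite [X in _ + X]nrmZ cabs_nat.
have := hZ (eig_u uuu).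
have := nrm_block_RS AT uuu vvv d01 hA (eig_u uuu).
have : nrm (P2 (R2 (P1 (S (P2 (S u)))))) <= nrm (P2 (S u)).
  apply: le_trans (nrm_P2_R2 AT uuu vvv _) _; apply: le_trans (nrm_Peirce1 AT uuu _) _.
  exact: (nrm_tripotent_op AT vvv).
have := nrm_P2_S_u; have := d_nrm_u; have d0 : 0 <= d by case/andP: d01.
lra.
Qed.

(** Up to terms already estimated, [P2 R2 P1 R2 u] is four times this vector,
    since [R2 = 2 S^2 - S]. *)
Lemma nrm_path21112 : nrm (P2 (S (P1 (S (P1 (S y)))))) <= 6 * d.
Proof.
move: (P1 (S y)) nrm_path2112 nrm_R2_path112 => p hS hR.
have e : 2 *: P2 (S (P1 (S p))) = P2 (R2 p) + P2 (S p) - 2 *: P2 (S (P2 (S p))).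
  have h := P2_S_split AT v uuu (S p).
  have -> : P2 (R2 p) + P2 (S p) = 2 *: P2 (S (S p)).
    by rewrite -(Peirce2D JT) -S_sqr (Peirce2Z JT).
  by rewrite h; lmod.
apply: (nrm_le_scale (n := 2%N)) => //.
rewrite e; apply: le_trans (nrmB _ _) _; apply: le_trans (lerD (nrmD _ _) (lexx _)) _.
rewrite [X in _ + X]nrmZ cabs_nat.
have := nrm_P2_S AT uuu vvv (P2 (S p)).
lra.
Qed.

(** Together with the paths [2,1,1,1,2] and [2,1,2,1,2] this one makes up
    [P2 S P1 S^3 u], up to the small vector [P2 S u]; and [S^3] is a combination
    of [R2] and [S]. *)
Lemma nrm_path21012 : nrm (P2 (S (P1 (S (P0 (S y)))))) <= 11 * d.
Proof.
have e : P2 (S (P1 (S (P0 (S y)))))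
    = P2 (S (P1 (S (S y)))) - P2 (S (P1 (S (P1 (S y))))) - P2 (S (P1 (S (P2 (S y))))).
  have -> : P0 (S y) = S y - P1 (S y) - P2 (S y).
    by rewrite -[X in X - _ - _](Peirce_sum tp u (S y)); lmod.
  move: (P1 (S y)) (P2 (S y)) => a b.
  by rewrite !(tpDr JT) !(tpNr JT) !(Peirce1D JT) !(Peirce1N JT) !(tpDr JT) !(tpNr JT)
    !(Peirce2D JT) !(Peirce2N JT).
have e2 : 4 *: P2 (S (P1 (S (S y)))) = 3 *: P2 (S (P1 (R2 u))) + P2 (S (P1 (S u)))
    - 4 *: P2 (S (P1 (S (S (P2 (S u)))))).
  have cub : 3 *: R2 u + S u = 4 *: S (S (S u)).
    rewrite /Peirce2; have h := tripotent_cubic JT vvv u.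
    have -> : 4 *: S (S (S u)) = 2 *: (2 *: S (S (S u))) by lmod.
    by rewrite h; lmod.
  have -> : 3 *: P2 (S (P1 (R2 u))) + P2 (S (P1 (S u))) = 4 *: P2 (S (P1 (S (S (S u))))).
    rewrite -(Peirce2Z JT) -(tpZr JT) -(Peirce1Z JT) -(Peirce2D JT) -(tpDr JT) -(Peirce1D JT) cub.
    by rewrite (Peirce1Z JT) (tpZr JT) (Peirce2Z JT).
  rewrite [in X in _ = 4 *: P2 (S (P1 (S (S X)))) - _]Su_split.
  move: (P2 (S u)) => z.
  by rewrite (tpDr JT) (tpDr JT) (Peirce1D JT) (tpDr JT) (Peirce2D JT); lmod.
have b1 : nrm (P2 (S (P1 (S (S y))))) <= 3 * d.
  apply: (nrm_le_scale (n := 4%N)) => //.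
  rewrite e2; apply: le_trans (nrmB _ _) _; apply: le_trans (lerD (nrmD _ _) (lexx _)) _.
  rewrite [X in _ + X]nrmZ [X in X + _ + _]nrmZ !cabs_nat.
  have := nrm_block_SR AT uuu vvv d01 hK hA (eig_u uuu).
  have := nrm_block_SS AT uuu vvv d01 hK hA (eig_u uuu).
  have := nrm_P2_S_P1_S (S (P2 (S u))).
  have := nrm_tripotent_op AT vvv (P2 (S u)).
  by have := nrm_P2_S_u; have := d_nrm_u; lra.
have b3 : nrm (P2 (S (P1 (S (P2 (S y)))))) <= 2 * d.
  apply: le_trans (nrm_P2_S_P1_S _) _.
  have := nrm_block_SS AT uuu vvv d01 hK hA (eig_u uuu).
  by have := d_nrm_u; lra.
rewrite e; apply: le_trans (nrmB _ _) _; apply: le_trans (lerD (nrmB _ _) (lexx _)) _.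
by have := nrm_path21112; lra.
Qed.

(** The path [2,1,0,1,2] is computed by the block formulas; [tp_u_y_w] brings in
    the cube of [y]. *)
Lemma nrm_tp_u_y_cube : nrm (tp u y y3) <= 11 * d.
Proof.
have ey := eig_y.
have eg : eig tp u 2 (tp u y y) by apply: (eig_tp JT (eig_u uuu) ey ey); rewrite ?conjC1 //; ring.
have ew : eig tp u 0 (tp y u y) by apply: (eig_tp JT ey (eig_u uuu) ey); rewrite ?conjC_nat //; ring.
have e3 : eig tp u 1 y3 by apply: (eig_tp JT ey ey ey); rewrite ?conjC1 //; ring.
have h0 : P2 (S (P1 (S (P0 (S y))))) = 8 *: P2 (S (tp (tp u y y) u y)) - 4 *: tp u y y3.
  rewrite (block01 JT v uuu ey) (tpZr JT) (Peirce1Z JT) (block10 JT v uuu ew).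
  rewrite (tp_u_y_w JT ey).
  have -> : 2 *: (4 *: tp (tp u y y) u y - y3) = 8 *: tp (tp u y y) u y - 2 *: y3 by lmod.
  rewrite (tpDr JT) (tpNr JT) (tpZr JT 8) (tpZr JT 2) (Peirce2D JT) (Peirce2N JT).
  rewrite (Peirce2Z JT _ 8) (Peirce2Z JT _ 2).
  by rewrite (block21 JT v uuu e3); lmod.
have ng : nrm (P2 (S (tp (tp u y y) u y))) <= 4 * d.
  apply: le_trans (nrm_P2_S AT uuu vvv _) _.
  have := nrm_tp_le AT nrm_g nrm_u nrm_y; lra.
have h1 : 4 *: tp u y y3 = 8 *: P2 (S (tp (tp u y y) u y)) - P2 (S (P1 (S (P0 (S y))))).
  by rewrite h0; lmod.
apply: (nrm_le_scale (n := 4%N)) => //.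
rewrite h1; apply: le_trans (nrmB _ _) _; rewrite [X in X + _]nrmZ cabs_nat.
have d0 : 0 <= d by case/andP: d01.
have := nrm_path21012; lra.
Qed.

Lemma nrm_y_cube : nrm y3 <= 1.
Proof.
apply: le_trans (at_bound AT _ _) _.
by rewrite -exprSr exprn_ile1 ?nrm_ge0 ?nrm_y.
Qed.

(** By [L_commutator], [L y3] is made of [{g,u,y3}], [{y,u,{u,y,y3}}] and
    [{u,y,{y,u,y3}}]; the last one is small by [tp_y_u_cube]. *)
Lemma nrm_quintic : nrm (L y3) <= 400 * d.
Proof.
have ng := nrm_g; have nu := nrm_u; have ny := nrm_y; have n3 := nrm_y_cube.
have nw : nrm (tp y u y) <= 4 by have := nrm_tp_le AT ny nu ny; lra.
have b1 : nrm (tp y u y3) <= 34 * d.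
  have h3 : nrm (tp y (tp u y y) y) <= 4 * d by have := nrm_tp_le AT ny ng ny; lra.
  have h4 : nrm (tp (tp u y y) u (tp y u y)) <= 16 * d by have := nrm_tp_le AT ng nu nw; lra.
  have h5 : nrm (tp (tp u y y) u y) <= 4 * d by have := nrm_tp_le AT ng nu ny; lra.
  have h6 : nrm (tp y u (tp (tp u y y) u y)) <= 16 * d by have := nrm_tp_le AT ny nu h5; lra.
  have d0 : 0 <= d by case/andP: d01.
  apply: (nrm_le_scale (n := 3%N)) => //.
  rewrite (tp_y_u_cube JT uuu eig_y).
  apply: le_trans (nrmD _ _) _; apply: le_trans (lerD (nrmD _ _) (lexx _)) _.
  by rewrite !nrmZ !cabs_nat; lra.
have h1 : nrm (tp (tp u y y) u y3) <= 4 * d by have := nrm_tp_le AT ng nu n3; lra.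
have h2 : nrm (tp y u (tp u y y3)) <= 44 * d by have := nrm_tp_le AT ny nu nrm_tp_u_y_cube; lra.
have h3 : nrm (tp u y (tp y u y3)) <= 136 * d by have := nrm_tp_le AT nu ny b1; lra.
have d0 : 0 <= d by case/andP: d01.
rewrite (L_commutator JT eig_y).
apply: le_trans (nrmB _ _) _; apply: le_trans (lerD (nrmD _ _) (lexx _)) _.
by rewrite !nrmZ !cabs_nat; lra.
Qed.

End Vectors.

(** * Orthogonality of the tripotents *)

(** The estimate for isometric exponentials makes the cube of [y] small. By
    [L_sqr] and [L_quadratic] this makes [L(y,y)^3] small on the unit ball; two
    further applications of the estimate reach [L(y,y)], whose norm is [|y|^2]. *)
Lemma small_of_quintic {R : realType} (eps : R) : 0 < eps ->
  exists2 del : R, 0 < del & forall (C : numClosedFieldType) (RC : complexOver R C)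
    (E : completeNormedModType C) (tp : E -> E -> E -> E) (y : E),
    analytic_triple tp -> nrm y <= 1 -> nrm (tp y y (tp y y y)) <= del -> nrm y <= eps.
Proof.
move=> e0; have e3 : 0 < eps ^+ 2 by rewrite exprn_gt0.
have [d3 d30 h3] := isometric_exp_sqr_small e3 (@ltr01 R) (@ltr01 R).
have [d2 d20 h2] := isometric_exp_sqr_small d30 (@ltr01 R) (@ltr01 R).
have d2' : 0 < d2 / 10 by apply: divr_gt0 d20 _; rewrite ltr0n.
have [d1 d10 h1] := isometric_exp_sqr_small d2' (@ltr01 R) (@ltr01 R).
exists d1 => // C RC E tp y AT y1 quint; have JT := at_jordan AT.
have T1 x : nrm (tp y y x) <= 1 * nrm x.
  apply: le_trans (at_bound AT _ _) _; rewrite ler_wpM2r ?nrm_ge0 //.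
  by rewrite exprn_ile1 ?nrm_ge0.
have iso x t : nrm (expi t (tp y y) x) = nrm x by exact: (at_expi AT).
have cube : nrm (tp y y y) <= d2 / 10 := h1 C RC E _ y T1 (iso y) y1 quint.
rewrite -(ler_pXn2r (n := 2)) ?nnegrE ?nrm_ge0 ?(ltW e0) //.
apply: (at_sharp AT) => x x1.
have Tx z : nrm z <= 1 -> nrm (tp y y z) <= 1.
  by move=> z1; apply: le_trans (T1 z) _; rewrite mul1r.
apply: (h3 C RC E _ x T1 (iso x) x1).
apply: (h2 C RC E _ _ T1 (iso _) (Tx _ x1)).
have e : 2 *: tp y y (tp y y (tp y y x))
    = tp (tp y y y) (tp y x y) y + tp y y (tp x y (tp y y y)).
  by rewrite -(tpZr JT) (L_sqr JT) (tpDr JT) (L_quadratic JT).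
apply: (nrm_le_scale (n := 2%N)) => //.
rewrite e; apply: le_trans (nrmD _ _) _.
have q1 : nrm (tp y x y) <= 4 by have := nrm_tp_le AT y1 x1 y1; lra.
have q2 : nrm (tp (tp y y y) (tp y x y) y) <= 16 * (d2 / 10).
  by have := nrm_tp_le AT cube q1 y1; lra.
have q3 : nrm (tp y y (tp x y (tp y y y))) <= 4 * (d2 / 10).
  by apply: le_trans (T1 _) _; have := nrm_tp_le AT x1 y1 cube; lra.
lra.
Qed.

(** The tolerance [eps / 12] bounds both parts of [S u = y + P2 S u], and
    [u - P_0(v) u = 3 S u - 2 S^2 u] is at most five times [S u]. *)
Lemma orthogonality_estimate {R : realType} (eps : R) : 0 < eps ->
  exists2 del : R, 0 < del & forall (C : numClosedFieldType) (RC : complexOver R C)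
    (E : completeNormedModType C) (tp : E -> E -> E -> E) (u v : E),
    analytic_triple tp -> tp u u u = u -> tp v v v = v ->
    nrm (u + v) <= 1 + del -> nrm (u - v) <= 1 + del ->
    nrm (u - Peirce0 tp v u) < eps.
Proof.
move=> e0; have e12 : 0 < eps / 12 by apply: divr_gt0 e0 _; rewrite ltr0n.
have [d5 d50 h5] := small_of_quintic e12.
have d5' : 0 < d5 / 400 by apply: divr_gt0 d50 _; rewrite ltr0n.
pose d := Num.min 1 (Num.min (d5 / 400) (eps / 12)).
have d0 : 0 < d by rewrite !lt_min ltr01 d5' e12.
have d1 : d <= 1 by rewrite ge_min lexx.
have dd5 : d <= d5 / 400 by rewrite !ge_min lexx orbT.
have de : d <= eps / 12 by rewrite !ge_min lexx !orbT.
have [dZ dZ0 hZ] := double_Peirce2_block_small d0.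
pose a := Num.min d dZ; have a0 : 0 < a by rewrite lt_min d0.
have [dA dA0 hA] := compressed_Peirce2_small a0.
pose k := Num.min a dA; have k0 : 0 < k by rewrite lt_min a0.
have [dK dK0 hK] := compressed_L_small k0.
exists dK => // C RC E tp u v AT uuu vvv hp hm; have JT := at_jordan AT.
have weaken (b c : R) (f : E -> E) : b <= c ->
    (forall x, eig tp u 2 x -> nrm (f x) <= b * nrm x) ->
    forall x, eig tp u 2 x -> nrm (f x) <= c * nrm x.
  by move=> bc h x Fx; apply: le_trans (h x Fx) _; rewrite ler_wpM2r ?nrm_ge0.
have ka : k <= a by rewrite ge_min lexx.
have kA : k <= dA by rewrite ge_min lexx orbT.
have ad : a <= d by rewrite ge_min lexx.
have aZ : a <= dZ by rewrite ge_min lexx orbT.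
have HK := hK C RC E tp u v AT uuu vvv hp hm.
have HA := hA C RC E tp u v AT uuu vvv (weaken _ _ _ kA HK).
have HZ := hZ C RC E tp u v AT uuu vvv (weaken _ _ _ (le_trans ka aZ) HK) (weaken _ _ _ aZ HA).
have HKd := weaken _ _ _ (le_trans ka ad) HK; have HAd := weaken _ _ _ ad HA.
have d01 : 0 <= d <= 1 by rewrite (ltW d0).
have cube := nrm_quintic AT uuu vvv d01 HKd HAd HZ.
have ny : nrm (Peirce1 tp u (tp v v u)) <= eps / 12.
  apply: (h5 C RC E tp) => //; first exact: (nrm_y AT uuu vvv).
  apply: le_trans cube _; lra.
have n2 := nrm_P2_S_u AT uuu d01 HKd.
have nS : nrm (tp v v u) <= eps / 6.
  rewrite (Su_split AT v uuu); apply: le_trans (nrmD _ _) _; lra.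
have -> : u - Peirce0 tp v u = 3 *: tp v v u - 2 *: tp v v (tp v v u).
  by rewrite /Peirce0; lmod.
apply: le_lt_trans (nrmB _ _) _; rewrite !nrmZ !cabs_nat.
have := nrm_tripotent_op AT vvv (tp v v u).
lra.
Qed.

(** * The operator norm as a supremum *)

Section OperatorNorm.
Context {R : realType} {C : numClosedFieldType} {RC : complexOver R C}.
Context {E : completeNormedModType C}.
Variable T : E -> E.
Hypothesis linT : linear_op T.
Hypothesis contT : continuous T.

Lemma continuous_bounded : exists M : R, forall x, nrm x <= 1 -> nrm (T x) <= M.
Proof.
have T0 : (T x @[x --> (0 : E)] --> T 0)%classic by exact: contT.
move/cvgrPdist_lt: T0 => /(_ 1 ltr01); rewrite (linear_op0 linT).
move=> /nbhs_normP[e /= e0 he].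
have [r r0 eE] : exists2 r : R, 0 < r & e = rc r.
  have eE : e = rc (re e) by rewrite rc_re; apply/esym/Creal_ReP/gtr0_real.
  by exists (re e); rewrite // -ltr_rc rmorph0 -eE.
have r2 : 0 < r / 2 by rewrite divr_gt0.
exists (2 / r) => x x1.
have : nrm (T (rc (r / 2) *: x)) < 1.
  rewrite -ltr_rc rmorph1 -nrmE -normrN -sub0r; apply: he.
  rewrite /ball_ /= sub0r normrN eE nrmE ltr_rc nrmZ cabs_rc gtr0_norm //.
  have : r / 2 * nrm x <= r / 2 by rewrite ler_piMr // ltW.
  lra.
case: linT => _ ->; rewrite nrmZ cabs_rc gtr0_norm // => lt1.
by rewrite ler_pdivlMr //; lra.
Qed.

Definition operator_norm : R := sup [set nrm (T x) | x in [set x | nrm x <= 1]]%classic.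

Lemma operator_norm_sup : has_sup [set nrm (T x) | x in [set x | nrm x <= 1]]%classic.
Proof.
split; first by exists (nrm (T 0)), 0 => //=; rewrite nrm0.
by have [M hM] := continuous_bounded; exists M => _ [x /= x1 <-]; exact: hM.
Qed.

Lemma nrm_operator_norm x : nrm (T x) <= operator_norm * nrm x.
Proof.
have [->|x0] := eqVneq x 0; first by rewrite (linear_op0 linT) nrm0 mulr0.
have nx : 0 < nrm x.
  by rewrite lt_neqAle nrm_ge0 andbT eq_sym; apply: contraNneq x0 => /nrm0_eq0 ->.
rewrite -ler_pdivrMr //.
have -> : nrm (T x) / nrm x = nrm (T (rc (nrm x)^-1 *: x)).
  by case: linT => _ ->; rewrite nrmZ cabs_rc gtr0_norm ?invr_gt0 // mulrC.
apply: (sup_upper_bound operator_norm_sup); exists (rc (nrm x)^-1 *: x) => //=.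
by rewrite nrmZ cabs_rc gtr0_norm ?invr_gt0 // mulVf ?gt_eqF.
Qed.

Lemma operator_norm_le c : (forall x, nrm x <= 1 -> nrm (T x) <= c) -> operator_norm <= c.
Proof.
move=> h; apply: (ge_sup operator_norm_sup.1) => _ [x /= x1 <-]; exact: h.
Qed.

End OperatorNorm.

(** * JB*-triples *)

Section JBstarTriples.
Local Open Scope complex_scope.
Variable R : realType.

Definition complex_complexOver : complexOver R R[i] :=
  @ComplexOver R R[i] (real_complex R) (@complex.Re R) (@complex.Im R)
    (@complexRe R) (@complexIm R) (@lecR R).

Variables (E : completeNormedModType R[i]) (tp : E -> E -> E -> E).
Hypothesis JB : JBstar_triple tp.

Lemma jordan_triple_of_JBstar : @jordan_triple R[i] E tp.
Proof.
have lin y z : linear (fun x => tp x y z) by exact: (JB_linear JB).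
have D x x' y z : tp (x + x') y z = tp x y z + tp x' y z.
  by have := lin y z 1 x x'; rewrite !scale1r.
have l0 y z : tp 0 y z = 0 by apply: (@addIr _ (tp 0 y z)); rewrite -D !add0r.
have Dm x y y' z : tp x (y + y') z = tp x y z + tp x y' z.
  by have := JB_conj_linear JB x z 1 y y'; rewrite conjC1 !scale1r.
have m0 x z : tp x 0 z = 0 by apply: (@addIr _ (tp x 0 z)); rewrite -Dm !add0r.
split.
- exact: (JB_sym JB).
- exact: D.
- by move=> a x y z; have := lin y z a x 0; rewrite l0 !addr0.
- exact: Dm.
- by move=> a x y z; have := JB_conj_linear JB x z a y 0; rewrite m0 !addr0.
- exact: (JB_jordan JB).
Qed.

Lemma analytic_triple_of_JBstar : @analytic_triple R R[i] complex_complexOver E tp.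
Proof.
have JT := jordan_triple_of_JBstar.
have lin a : @linear_op R[i] E (tp a a).
  by split=> *; rewrite ?(tpDr JT) ?(tpZr JT).
have cont a : continuous (tp a a) by case: (JB_hermitian JB a) => -[].
have opE a : @operator_norm R R[i] complex_complexOver E (tp a a) = rnorm a ^+ 2.
  exact: (JB_norm JB a).
split.
- exact: JT.
- move=> a x; have := @nrm_operator_norm R R[i] complex_complexOver E _ (lin a) (cont a) x.
  by rewrite opE.
- move=> a c h.
  have := @operator_norm_le R R[i] complex_complexOver E _ (lin a) (cont a) c h.
  by rewrite opE.
- move=> a t x; case: (JB_hermitian JB a) => _ h; exact: (h t x).
Qed.

End JBstarTriples.

Theorem proposition3p10 (R : realType) (eps : R) (heps : 0 < eps) :
  exists delta : R, 0 < delta /\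
    forall (E : completeNormedModType R[i]) (tp : E -> E -> E -> E) (u v : E),
      JBstar_triple tp -> tripotent tp u -> tripotent tp v ->
      1 - delta < rnorm (u + v) < 1 + delta ->
      1 - delta < rnorm (u - v) < 1 + delta ->
      rnorm (u - peirce0 tp v u) < eps /\ rnorm (v - peirce0 tp u v) < eps.
Proof.
have [d d0 h] := orthogonality_estimate heps.
exists d; split=> // E tp u v JB uuu vvv /andP[_ /ltW hp] /andP[_ /ltW hm].
have AT := analytic_triple_of_JBstar JB; have JT := at_jordan AT.
have P0E w x : peirce0 tp w x = Peirce0 tp w x.
  by rewrite /peirce0 /Peirce0 /Lop /= (tpBr JT) (tpZr JT); lmod.
rewrite !P0E; split.
  refine (h _ _ E tp u v AT uuu vvv hp hm).
refine (h _ _ E tp v u AT vvv uuu _ _).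
  by rewrite addrC.
by rewrite -opprB nrmN.
Qed.
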